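(* Let $\varphi:\mathbb{R}^n\to\overline{\mathbb{R}}$ be l.s.c. and subdifferentially continuous at $\bar x\in\operatorname{dom}\varphi$ for $\bar v\in\partial\varphi(\bar x)$. Then the following assertions are equivalent: (i) $\varphi$ is variationally convex at $\bar x$ for $\bar v$. (ii) $\varphi$ is prox-regular at $\bar x$ for $\bar v$ and there exist neighborhoods $U$ of $\bar x$ and $V$ of $\bar v$ such that $$\langle z,w\rangle\ge0\quad\text{whenever } z\in\breve\partial^2\varphi(x,y)(w),\ (x,y)\in\operatorname{gph}\partial\varphi\cap(U\times V),\ w\in\mathbb{R}^n.$$ (iii) $\varphi$ is prox-regular at $\bar x$ for $\bar v$ and there exist neighborhoods $U$ of $\bar x$ and $V$ of $\bar v$ such that $$\langle z,w\rangle\ge0\quad\text{whenever } z\in\partial^2\varphi(x,y)(w),\ (x,y)\in\operatorname{gph}\partial\varphi\cap(U\times V),\ w\in\mathbb{R}^n.$$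
   Context: Conventions: $\overline{\mathbb{R}}:=(-\infty,\infty]$; every extended-real-valued function is assumed proper, i.e. $\operatorname{dom}\varphi:=\{x\mid\varphi(x)<\infty\}\neq\emptyset$. $\mathbb{B}_\epsilon(a)$ is the closed ball with center $a$ and radius $\epsilon$; l.s.c. means lower semicontinuous. Subdifferentials: for $\bar x\in\operatorname{dom}\varphi$, the regular subdifferential is $$\widehat\partial\varphi(\bar x)=\Big\{v\in\mathbb{R}^n\;\Big|\;\liminf_{x\to\bar x}\frac{\varphi(x)-\varphi(\bar x)-\langle v,x-\bar x\rangle}{\|x-\bar x\|}\ge 0\Big\},$$ and the limiting subdifferential $\partial\varphi(\bar x)$ is the set of all $v$ for which there are $x_k\to\bar x$ with $\varphi(x_k)\to\varphi(\bar x)$ and $v_k\in\widehat\partial\varphi(x_k)$ with $v_k\to v$. For a set $\Omega$ with indicator function $\delta_\Omega$ ($0$ on $\Omega$, $\infty$ off $\Omega$) the regular and limiting normal cones at $\bar x\in\Omega$ are $\widehat N_\Omega(\bar x):=\widehat\partial\delta_\Omega(\bar x)$ and $N_\Omega(\bar x):=\partial\delta_\Omega(\bar x)$. Second-order subdifferentials: for $(x,y)\in\operatorname{gph}\partial\varphi$ and $w\in\mathbb{R}^n$, the combined and the limiting second-order subdifferentials are $$\breve\partial^2\varphi(x,y)(w):=\{z\mid(z,-w)\in\widehat N_{\operatorname{gph}\partial\varphi}(x,y)\},\qquad \partial^2\varphi(x,y)(w):=\{z\mid(z,-w)\in N_{\operatorname{gph}\partial\varphi}(x,y)\}.$$ Variational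 convexity: an l.s.c. function $\varphi$ is variationally convex at $\bar x$ for $\bar v\in\partial\varphi(\bar x)$ if for some convex neighborhood $U\times V$ of $(\bar x,\bar v)$ there exist an l.s.c. convex function $\psi\le\varphi$ on $U$ and a number $\epsilon>0$ such that $$(U_\epsilon\times V)\cap\operatorname{gph}\partial\varphi=(U\times V)\cap\operatorname{gph}\partial\psi\quad\text{and}\quad\varphi(x)=\psi(x)\ \text{at the common elements }(x,v),$$ where $U_\epsilon:=\{x\in U\mid\varphi(x)<\varphi(\bar x)+\epsilon\}$. Prox-regularity: an l.s.c. function $\varphi$ is prox-regular at $\bar x\in\operatorname{dom}\varphi$ for $\bar v\in\partial\varphi(\bar x)$ if there exist $\epsilon>0$ and $r\ge0$ such that $\varphi(x)\ge\varphi(u)+\langle v,x-u\rangle-\frac r2\|x-u\|^2$ for all $x\in\mathbb{B}_\epsilon(\bar x)$ and all $(u,v)\in\operatorname{gph}\partial\varphi\cap(\mathbb{B}_\epsilon(\bar x)\times\mathbb{B}_\epsilon(\bar v))$ with $\varphi(u)<\varphi(\bar x)+\epsilon$. Subdifferential continuity: $\varphi$ is subdifferentially continuous at $\bar x$ for $\bar v\in\partial\varphi(\bar x)$ if for every $\epsilon>0$ there is $\delta>0$ such that $|\varphi(x)-\varphi(\bar x)|<\epsilon$ whenever $(x,v)\in\operatorname{gph}\partial\varphi\cap(\mathbb{B}_\delta(\bar x)\times\mathbb{B}_\delta(\bar v))$. *)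

(* Defs.v *)
From HB Require Import structures.
From mathcomp Require Import all_boot all_order all_algebra.
From mathcomp Require Import all_classical all_reals all_analysis.

Set Implicit Arguments.
Unset Strict Implicit.
Unset Printing Implicit Defensive.

Import Order.TTheory GRing.Theory Num.Theory.
Import numFieldNormedType.Exports.

Local Open Scope classical_set_scope.
Local Open Scope ring_scope.

(* R^n is 'rV[R]_n.  The library norm on 'rV[R]_n is the sup norm, so the
   Euclidean norm is introduced here; both induce the library topology. *)

Definition dot (R : realType) (n : nat) (u v : 'rV[R]_n) : R :=
  \sum_(i < n) u 0 i * v 0 i.

Definition enorm (R : realType) (n : nat) (u : 'rV[R]_n) : R :=
  Num.sqrt (dot u u).

Definition eball (R : realType) (n : nat) (a : 'rV[R]_n) (e : R) :
  set 'rV[R]_n := [set x | enorm (x - a) <= e].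

Definition dom (R : realType) (n : nat) (phi : 'rV[R]_n -> \bar R) :
  set 'rV[R]_n := [set x | (phi x < +oo)%E].

(* Properness also excludes the value -oo, which \bar R allows. *)
Definition proper_fun (R : realType) (n : nat) (phi : 'rV[R]_n -> \bar R) :=
  (forall x, phi x != -oo%E) /\ dom phi !=set0.

(* The weights lie in the open interval, so no product 0 * +oo occurs. *)
Definition convex_efun (R : realType) (n : nat) (psi : 'rV[R]_n -> \bar R) :=
  forall (x y : 'rV[R]_n) (t : R), 0 < t -> t < 1 ->
    (psi (t *: x + (1 - t) *: y)%R
       <= t%:E * psi x + (1 - t)%:E * psi y)%E.

(* The lower limit is over the punctured neighborhoods xb^'.  Subdifferentials
   are empty outside the domain. *)
Definition regular_subdiff (R : realType) (n : nat)
    (phi : 'rV[R]_n -> \bar R) (xb : 'rV[R]_n) : set 'rV[R]_n :=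
  [set v | dom phi xb /\
    (0 <= limf_einf
            (fun x => (phi x - phi xb - (dot v (x - xb))%:E)
                        * ((enorm (x - xb))^-1)%:E)
            xb^')%E].

Definition limiting_subdiff (R : realType) (n : nat)
    (phi : 'rV[R]_n -> \bar R) (xb : 'rV[R]_n) : set 'rV[R]_n :=
  [set v | dom phi xb /\
    exists (x_ v_ : nat -> 'rV[R]_n),
      [/\ x_ @ \oo --> xb,
          (fun k => phi (x_ k)) @ \oo --> phi xb,
          (forall k, regular_subdiff phi (x_ k) (v_ k)) &
          v_ @ \oo --> v]].

Definition indicator (R : realType) (n : nat) (Omega : set 'rV[R]_n)
  (x : 'rV[R]_n) : \bar R := if x \in Omega then 0%E else +oo%E.

Definition regular_normal_cone (R : realType) (n : nat)
  (Omega : set 'rV[R]_n) (xb : 'rV[R]_n) : set 'rV[R]_n :=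
  regular_subdiff (indicator Omega) xb.

Definition limiting_normal_cone (R : realType) (n : nat)
  (Omega : set 'rV[R]_n) (xb : 'rV[R]_n) : set 'rV[R]_n :=
  limiting_subdiff (indicator Omega) xb.

Definition gph (R : realType) (n : nat)
    (F : 'rV[R]_n -> set 'rV[R]_n) : set ('rV[R]_n * 'rV[R]_n) :=
  [set p | F p.1 p.2].

(* R^n x R^n is identified with R^(n + n) to take normal cones, so that they
   refer to the Euclidean structure of the product. *)
Definition flat (R : realType) (n : nat)
    (G : set ('rV[R]_n * 'rV[R]_n)) : set 'rV[R]_(n + n) :=
  [set row_mx p.1 p.2 | p in G].

Definition combined_subdiff2 (R : realType) (n : nat)
    (phi : 'rV[R]_n -> \bar R) (x y w : 'rV[R]_n) : set 'rV[R]_n :=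
  [set z | regular_normal_cone (flat (gph (limiting_subdiff phi)))
             (row_mx x y) (row_mx z (- w))].

Definition limiting_subdiff2 (R : realType) (n : nat)
    (phi : 'rV[R]_n -> \bar R) (x y w : 'rV[R]_n) : set 'rV[R]_n :=
  [set z | limiting_normal_cone (flat (gph (limiting_subdiff phi)))
             (row_mx x y) (row_mx z (- w))].

(* U `*` V is a convex neighborhood of (xb, vb) iff U and V are convex
   neighborhoods of xb and vb. *)
Definition variationally_convex (R : realType) (n : nat)
    (phi : 'rV[R]_n -> \bar R) (xb vb : 'rV[R]_n) :=
  exists (U V : set 'rV[R]_n) (psi : 'rV[R]_n -> \bar R) (eps : R),
    let Ueps := [set x | U x /\ (phi x < phi xb + eps%:E)%E] in
    [/\ [/\ nbhs xb U, convex_set U, nbhs vb V & convex_set V],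
        [/\ proper_fun psi, lower_semicontinuous psi, convex_efun psi &
            forall x, U x -> (psi x <= phi x)%E],
        0 < eps,
        (Ueps `*` V) `&` gph (limiting_subdiff phi)
          = (U `*` V) `&` gph (limiting_subdiff psi) &
        forall x v, ((U `*` V) `&` gph (limiting_subdiff psi)) (x, v) ->
          phi x = psi x].

Definition prox_regular (R : realType) (n : nat)
    (phi : 'rV[R]_n -> \bar R) (xb vb : 'rV[R]_n) :=
  exists eps r : R, [/\ 0 < eps, 0 <= r &
    forall x u v : 'rV[R]_n,
      eball xb eps x ->
      (gph (limiting_subdiff phi) `&` (eball xb eps `*` eball vb eps)) (u, v) ->
      (phi u < phi xb + eps%:E)%E ->
      (phi u + (dot v (x - u))%:E - (r / 2 * enorm (x - u) ^+ 2)%:E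
         <= phi x)%E].

Definition subdiff_continuous (R : realType) (n : nat)
    (phi : 'rV[R]_n -> \bar R) (xb vb : 'rV[R]_n) :=
  forall eps : R, 0 < eps -> exists2 delta : R, 0 < delta &
    forall x v : 'rV[R]_n,
      (gph (limiting_subdiff phi) `&` (eball xb delta `*` eball vb delta))
        (x, v) ->
      (`|phi x - phi xb| < eps%:E)%E.

(* Main.v *)
(* (i) => (ii).  Near (xb, vb) the graph of the subdifferential of phi is that of
   the convex function psi, hence locally maximal monotone; following its
   resolvent from x + y in the direction z - w shows that a regular normal
   (z, - w) satisfies |z - w| <= |z + w|, that is <z, w> >= 0.

   (ii) => (i).  Put rho := r + 1.  By prox-regularity the graph is locally
   {(P y, y - rho P y)} with P single-valued and nonexpansive.  Regular normals
   to the graph correspond to regular supergradients c of <a, Q>, where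
   Q := 2 rho P - id, and <z, w> >= 0 becomes |c| <= |a|.  A fuzzy mean value
   argument then makes Q nonexpansive, which says that the graph is locally
   monotone; no differentiability of P is needed.  Monotonicity makes the Moreau
   envelope convex, so every nearby subgradient supports phi globally on a
   neighborhood of xb, and psi is the supremum of these supporting affine
   functions. *)

Require Import Defs.
From HB Require Import structures.
From mathcomp Require Import all_boot all_order all_algebra.
From mathcomp Require Import all_classical all_reals all_analysis.
From mathcomp Require Import ring lra.
Set Implicit Arguments.
Unset Strict Implicit.
Unset Printing Implicit Defensive.

Import Order.TTheory GRing.Theory Num.Theory.
Import numFieldNormedType.Exports.
Local Open Scope classical_set_scope.
Local Open Scope ring_scope.

(** * Euclidean structure *)

Section Euclid.
Context {R : realType} {n : nat}.
Implicit Types (u v w x y : 'rV[R]_n) (a : R).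

Lemma dotC u v : dot u v = dot v u.
Proof. by apply: eq_bigr => i _; rewrite mulrC. Qed.

Lemma dotDl u v w : dot (u + v) w = dot u w + dot v w.
Proof. by rewrite -big_split; apply: eq_bigr => i _; rewrite mxE mulrDl. Qed.

Lemma dotZl a u v : dot (a *: u) v = a * dot u v.
Proof. by rewrite mulr_sumr; apply: eq_bigr => i _; rewrite mxE mulrA. Qed.

Lemma dotNl u v : dot (- u) v = - dot u v.
Proof. by rewrite -scaleN1r dotZl mulN1r. Qed.

Lemma dotDr u v w : dot w (u + v) = dot w u + dot w v.
Proof. by rewrite dotC dotDl !(dotC w). Qed.

Lemma dotZr a u v : dot v (a *: u) = a * dot v u.
Proof. by rewrite dotC dotZl dotC. Qed.

Lemma dotNr u v : dot v (- u) = - dot v u.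
Proof. by rewrite dotC dotNl dotC. Qed.

Definition dotE := (dotDl, dotDr, dotNl, dotNr, dotZl, dotZr).

Lemma dot0r u : dot u 0 = 0.
Proof. by rewrite -[0](scale0r 0) dotZr mul0r. Qed.

Lemma dotvv_ge0 u : 0 <= dot u u.
Proof. by apply: sumr_ge0 => i _; rewrite -expr2 sqr_ge0. Qed.

Lemma enorm_ge0 u : 0 <= enorm u.
Proof. exact: sqrtr_ge0. Qed.

Lemma enorm_sqr u : enorm u ^+ 2 = dot u u.
Proof. by rewrite sqr_sqrtr // dotvv_ge0. Qed.

Lemma coord_le_enorm u (i : 'I_n) : `|u 0 i| <= enorm u.
Proof.
rewrite -(ler_pXn2r (ltn0Sn 1)) ?nnegrE ?enorm_ge0 // enorm_sqr real_normK ?num_real //.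
rewrite /dot (bigD1 i) //= -expr2 lerDl; apply: sumr_ge0 => j _.
by rewrite -expr2 sqr_ge0.
Qed.

Lemma enorm_eq0 u : enorm u = 0 -> u = 0.
Proof.
move=> u0; apply/rowP => i; rewrite mxE; apply/eqP; rewrite -normr_le0.
by rewrite -u0 coord_le_enorm.
Qed.

Lemma enorm0 : enorm (0 : 'rV[R]_n) = 0.
Proof. by rewrite /enorm dot0r sqrtr0. Qed.

Lemma enormN u : enorm (- u) = enorm u.
Proof. by rewrite /enorm !dotE opprK. Qed.

Lemma enormBC u v : enorm (u - v) = enorm (v - u).
Proof. by rewrite -enormN opprB. Qed.

Lemma enormZ a u : enorm (a *: u) = `|a| * enorm u.
Proof. by rewrite /enorm !dotE mulrA -expr2 sqrtrM ?sqr_ge0 // sqrtr_sqr. Qed.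

(** Cauchy-Schwarz: expand the square of [|v| u - |u| v] and divide by [|u| |v|]. *)
Lemma dot_le_enorm u v : dot u v <= enorm u * enorm v.
Proof.
have [v0|v0] := eqVneq (enorm v) 0.
  by rewrite (enorm_eq0 v0) dot0r enorm0 mulr0.
have vp : 0 < enorm v by rewrite lt_neqAle eq_sym v0 enorm_ge0.
have [u0|u0] := eqVneq (enorm u) 0.
  by rewrite (enorm_eq0 u0) dotC dot0r enorm0 mul0r.
have up : 0 < enorm u by rewrite lt_neqAle eq_sym u0 enorm_ge0.
have := dotvv_ge0 (enorm v *: u - enorm u *: v).
rewrite !dotE (dotC v u) -!enorm_sqr => H.
rewrite -(ler_pM2l (mulr_gt0 up vp)); nra.
Qed.

Lemma dot_ge_enorm u v : - (enorm u * enorm v) <= dot u v.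
Proof. by rewrite lerNl -dotNl -(enormN u) dot_le_enorm. Qed.

Lemma le_enorm u v : dot u u <= dot v v -> enorm u <= enorm v.
Proof. by move=> uv; apply: ler_wsqrtr. Qed.

Lemma enormD u v : enorm (u + v) <= enorm u + enorm v.
Proof.
rewrite -(ler_pXn2r (ltn0Sn 1)) ?nnegrE ?addr_ge0 ?enorm_ge0 //.
rewrite enorm_sqr !dotE (dotC v u) -!enorm_sqr; have := dot_le_enorm u v; nra.
Qed.

Lemma enormB u v : enorm (u - v) <= enorm u + enorm v.
Proof. by rewrite -(enormN v) enormD. Qed.

Lemma enorm_tri w u v : enorm (u - v) <= enorm (u - w) + enorm (w - v).
Proof. by have := enormD (u - w) (w - v); rewrite addrA subrK. Qed.

Lemma norm_le_enorm u : `|u| <= enorm u.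
Proof.
rewrite /Num.norm/= mx_normrE; elim/big_ind: _ => [|a b ha hb|[i j] _].
- exact: enorm_ge0.
- by rewrite ge_max ha.
- by rewrite ord1 coord_le_enorm.
Qed.

Lemma coord_le_norm u (i : 'I_n) : `|u 0 i| <= `|u|.
Proof.
rewrite [leRHS]/Num.norm/= mx_normrE.
by rewrite (le_bigmax (0 : R) (fun ij : 'I_1 * 'I_n => `|u ij.1 ij.2|) (0, i)).
Qed.

Lemma enorm_le_norm u : enorm u <= Num.sqrt n%:R * `|u|.
Proof.
rewrite -[`|u|]ger0_norm // -sqrtr_sqr -sqrtrM ?ler0n //; apply: ler_wsqrtr.
have -> : n%:R * `|u| ^+ 2 = \sum_(i < n) `|u| ^+ 2.
  by rewrite sumr_const card_ord mulr_natl.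
apply: ler_sum => i _; rewrite -expr2 -real_normK ?num_real //.
by rewrite ler_pXn2r ?nnegrE // coord_le_norm.
Qed.

(** The sup norm and the Euclidean norm bound each other up to the factor [sqrt n], so every
    topological argument can be run with Euclidean balls. *)
Lemma nbhs_eballP x (A : set 'rV[R]_n) :
  nbhs x A <-> exists2 d, 0 < d & eball x d `<=` A.
Proof.
split.
- move=> /(nbhs_normP x)[e /= e0 eA]; exists (e / 2); first by rewrite divr_gt0.
  move=> y yx; apply: eA => /=; rewrite distrC.
  by apply: le_lt_trans (norm_le_enorm _) _; apply: le_lt_trans yx _; lra.
- case=> d d0 dA; apply/(nbhs_normP x); exists (d / (Num.sqrt n%:R + 1)) => /=.
    by rewrite divr_gt0 // ltr_pwDr // sqrtr_ge0.
  move=> y /=; rewrite distrC => yx; apply: dA; rewrite /eball /=.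
  apply: le_trans (enorm_le_norm _) _.
  have s0 : 0 <= Num.sqrt n%:R :> R by rewrite sqrtr_ge0.
  move: yx; rewrite ltr_pdivlMr ?ltr_pwDr // => yx.
  have := normr_ge0 (y - x); nra.
Qed.

Lemma nbhs_eball x (d : R) : 0 < d -> nbhs x (eball x d).
Proof. by move=> d0; apply/nbhs_eballP; exists d. Qed.

Lemma eball_center x (d : R) : 0 <= d -> eball x d x.
Proof. by rewrite /eball /= subrr enorm0. Qed.

Lemma eballS x (d e : R) : d <= e -> eball x d `<=` eball x e.
Proof. by move=> de y /le_trans; exact. Qed.

Lemma eball_convex x u v (d t : R) : 0 <= t -> t <= 1 ->
  eball x d u -> eball x d v -> eball x d (t *: u + (1 - t) *: v).
Proof.
rewrite /eball /= => t0 t1 ux vx.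
have -> : t *: u + (1 - t) *: v - x = t *: (u - x) + (1 - t) *: (v - x).
  by apply/rowP => i; rewrite !mxE; ring.
apply: le_trans (enormD _ _) _; rewrite !enormZ !ger0_norm ?subr_ge0 //; nra.
Qed.

Lemma eball_convex_set x (d : R) : convex_set (eball x d).
Proof.
apply/convex_setW => u v; rewrite !inE => ux vx t t0 t1; rewrite inE.
exact: eball_convex (ltW t0) (ltW t1) ux vx.
Qed.

Lemma eball_compact x (d : R) : compact (eball x d).
Proof.
apply: bounded_closed_compact.
  exists (enorm x + d); split; first by rewrite num_real.
  move=> M hM y; rewrite /eball /= => yx; apply: le_trans (norm_le_enorm _) _.
  apply: le_trans (ltW hM); rewrite -[y](subrK x) addrC.
  by apply: le_trans (enormD _ _) _; rewrite lerD2l.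
rewrite closedE /= => y yN; rewrite /eball /=.
rewrite leNgt; apply/negP => xy; apply: yN.
apply/nbhs_eballP; exists ((enorm (y - x) - d) / 2); first by rewrite divr_gt0 ?subr_gt0.
move=> z; rewrite /eball /= => zy zx.
by have := enorm_tri z y x; rewrite (enormBC y z); lra.
Qed.

Lemma cvg_dot {T} {F : set_system T} {FF : Filter F} (f g : T -> 'rV[R]_n) u v :
  f @ F --> u -> g @ F --> v -> (fun k => dot (f k) (g k)) @ F --> dot u v.
Proof.
move=> fu gv; rewrite /dot.
apply: (@cvg_big R _ +%R 0 xpredT (@add_continuous R) T F _
  (fun i k => f k 0 i * g k 0 i)) => i _.
have cc (h : T -> 'rV[R]_n) w : h @ F --> w -> (fun k => h k 0 i) @ F --> w 0 i.
  by move=> hw; exact: (cvg_comp _ _ hw (@coord_continuous R 1 n 0 i w)).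
by apply: cvgM; apply: cc.
Qed.

End Euclid.

(** * Subdifferentials and normal cones *)

Section Subdifferentials.
Context {R : realType} {n : nat}.
Implicit Types (phi psi : 'rV[R]_n -> \bar R) (u v w x y : 'rV[R]_n).

Lemma dom_fin phi x : phi x != -oo%E -> dom phi x -> phi x = (fine (phi x))%:E.
Proof. by rewrite /dom /=; case: (phi x) => // _. Qed.

(** Epsilon-delta form of the lower limit. With the quotient cleared, the inequality also makes
    sense at [y = x] and where [phi y] is infinite. *)
Lemma regular_subdiffP phi x v : (forall y, phi y != -oo%E) ->
  regular_subdiff phi x v <->
  dom phi x /\ forall e, 0 < e -> exists2 d, 0 < d & forall y, eball x d y ->
    (phi x + (dot v (y - x) - e * enorm (y - x))%:E <= phi y)%E.
Proof.
move=> phiN; rewrite /regular_subdiff /= limf_einfE.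
split=> -[xdom H]; split=> //; have xE := dom_fin (phiN x) xdom.
- move=> e e0; have /ereal_sup_gt[_ [V xV <-] eV] :
      ((- e)%:E < ereal_sup [set ereal_inf [set ((phi z - phi x - (dot v (z - x))%:E)
        * ((enorm (z - x))^-1)%:E)%E | z in V] | V in x^'])%E.
    by apply: lt_le_trans H; rewrite lte_fin oppr_lt0.
  have /nbhs_eballP[d d0 dV] : nbhs x (fun y => y != x -> V y) by exact: xV.
  exists d => // y yd; have [->|yx] := eqVneq y x.
    by rewrite subrr enorm0 dot0r mulr0 subr0 adde0.
  have N0 : 0 < enorm (y - x).
    rewrite lt_neqAle enorm_ge0 andbT eq_sym; apply/eqP => /enorm_eq0/eqP.
    by rewrite subr_eq0 (negPf yx).
  have : ((- e)%:E <= (phi y - phi x - (dot v (y - x))%:E)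
            * ((enorm (y - x))^-1)%:E)%E.
    apply: le_trans (ltW eV) _; apply: ereal_inf_lbound.
    by exists y => //; apply: dV.
  rewrite xE; case: (phi y) (phiN y) => [p _|_ _|//]; last by rewrite leey.
  rewrite -!EFinB -EFinM -EFinD !lee_fin ler_pdivlMr //; lra.
- apply/lee_addgt0Pr => e e0; have [d d0 dV] := H _ e0.
  rewrite -leeBlDr // sub0e; pose V := [set y | y != x /\ eball x d y].
  apply: (@le_trans _ _ (ereal_inf [set ((phi z - phi x - (dot v (z - x))%:E)
        * ((enorm (z - x))^-1)%:E)%E | z in V])).
    apply: le_ereal_inf_tmp => _ [y [yx yd] <-].
    have N0 : 0 < enorm (y - x).
      rewrite lt_neqAle enorm_ge0 andbT eq_sym; apply/eqP => /enorm_eq0/eqP.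
      by rewrite subr_eq0 (negPf yx).
    have := dV _ yd; rewrite xE; case: (phi y) (phiN y) => [p _|_ _|//].
      by rewrite -EFinN -!EFinB -EFinM -EFinD !lee_fin ler_pdivlMr //; lra.
    by rewrite /= gt0_mulye ?lte_fin ?invr_gt0 // leey.
  apply: ereal_sup_ubound; exists V => //.
  by apply/nbhs_eballP; exists d => // y yd yx; split.
Qed.

Lemma regular_limiting phi x v :
  regular_subdiff phi x v -> limiting_subdiff phi x v.
Proof.
move=> xv; split; first by case: xv.
by exists (fun=> x), (fun=> v); split=> //; apply: cvg_cst.
Qed.

(** A quadratic error is of smaller order: within distance [e / (r + 1)] it is at most
    [e |y - x|]. *)
Lemma quad_regular_subdiff phi x v (r d : R) : (forall y, phi y != -oo%E) ->
  dom phi x -> 0 <= r -> 0 < d ->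
  (forall y, eball x d y ->
    (phi x + (dot v (y - x) - r / 2 * enorm (y - x) ^+ 2)%:E <= phi y)%E) ->
  regular_subdiff phi x v.
Proof.
move=> phiN xdom r0 d0 H; apply/regular_subdiffP => //; split=> // e e0.
exists (Num.min d (e / (r + 1))); first by rewrite lt_min d0 divr_gt0 ?ltr_wpDl.
move=> y; rewrite /eball /= le_min => /andP[yd ye].
apply: le_trans (H _ yd); rewrite leeD2l // lee_fin lerD2l lerN2.
move: ye; rewrite ler_pdivlMr ?ltr_wpDl // => ye.
have N0 := enorm_ge0 (y - x); nra.
Qed.

End Subdifferentials.

(** * Subgradients of convex functions *)

Section Convex.
Context {R : realType} {n : nat}.
Implicit Types (phi psi : 'rV[R]_n -> \bar R) (u v w x y : 'rV[R]_n).

(** The local inequality holds at [x + t (y - x)] for small [t]; convexity along the segment and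
    division by [t] carry it to [y]. *)
Lemma convex_regular_subdiff psi x v : (forall y, psi y != -oo%E) ->
  convex_efun psi -> regular_subdiff psi x v ->
  forall y, (psi x + (dot v (y - x))%:E <= psi y)%E.
Proof.
move=> psiN cvx /regular_subdiffP[]// xdom H y.
have xE := dom_fin (psiN x) xdom; rewrite xE.
case yE : (psi y) (psiN y) => [q| |//] _; last by rewrite leey.
rewrite -EFinD lee_fin; apply/ler_addgt0Pr => e e0.
have e1 : 0 < e / (enorm (y - x) + 1) by rewrite divr_gt0 // ltr_wpDl ?enorm_ge0.
have [d d0 dV] := H _ e1.
have N1 : 0 < enorm (y - x) + 1 by rewrite ltr_wpDl ?enorm_ge0.
pose t := Num.min (1/2) (d / (enorm (y - x) + 1)).
have t0 : 0 < t by rewrite lt_min divr_gt0 //= divr_gt0.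
have t1 : t < 1 by rewrite gt_min; apply/orP; left; lra.
have td : t * (enorm (y - x) + 1) <= d.
  by rewrite -ler_pdivlMr // ge_min lexx orbT.
have zE : t *: y + (1 - t) *: x - x = t *: (y - x).
  by apply/rowP => i; rewrite !mxE; ring.
have := dV (t *: y + (1 - t) *: x).
rewrite /eball /= zE enormZ (gtr0_norm t0) dotZr => /(_ _)/le_trans.
move=> /(_ _ _ (cvx y x t t0 t1)); rewrite xE yE -!EFinM -!EFinD lee_fin => K.
have N0 := enorm_ge0 (y - x).
have {}K := K ltac:(lra).
have eN : e / (enorm (y - x) + 1) * enorm (y - x) <= e.
  by rewrite mulrAC ler_pdivrMr //; nra.
rewrite -(ler_pM2l t0); nra.
Qed.

Lemma cvg_eball {T} {F : set_system T} {FF : Filter F} (f : T -> 'rV[R]_n) x (d : R) :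
  f @ F --> x -> 0 < d -> \forall k \near F, eball x d (f k).
Proof. by move=> fx d0; apply: fx; exact: nbhs_eball. Qed.

(** The global inequality for regular subgradients survives the limits that define
    [limiting_subdiff]. *)
Lemma convex_limiting_subdiff psi x v : (forall y, psi y != -oo%E) ->
  convex_efun psi -> limiting_subdiff psi x v ->
  forall y, (psi x + (dot v (y - x))%:E <= psi y)%E.
Proof.
move=> psiN cvx [xdom [x_ [v_ [x_x psix xv vv]]]] y.
have xE := dom_fin (psiN x) xdom; rewrite xE.
case yE : (psi y) (psiN y) => [q| |//] _; last by rewrite leey.
have kE k : psi (x_ k) = (fine (psi (x_ k)))%:E.
  by apply: dom_fin => //; case: (xv k).
have le_k k : fine (psi (x_ k)) + dot (v_ k) (y - x_ k) <= q.
  rewrite -lee_fin EFinD -kE -yE; exact: convex_regular_subdiff.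
have cvk : (fun k => fine (psi (x_ k)) + dot (v_ k) (y - x_ k)) @ \oo -->
    fine (psi x) + dot v (y - x).
  apply: cvgD; last by apply: cvg_dot => //; apply: cvgB => //; apply: cvg_cst.
  apply: (@fine_cvg _ _ _ _ (fun k => psi (x_ k))); by rewrite -xE.
rewrite -EFinD lee_fin.
by apply: (closed_cvg _ (@closed_le R q) _ _ cvk); apply: nearW => k; exact: le_k.
Qed.

End Convex.

(** * Normal cones in the product space *)

Section NormalCones.
Context {R : realType} {n : nat}.
Implicit Types (G : set ('rV[R]_n * 'rV[R]_n)) (x y z w : 'rV[R]_n).

Lemma dot_row_mx x y z w : dot (row_mx x y) (row_mx z w) = dot x z + dot y w.
Proof.
rewrite /dot big_split_ord /=; congr (_ + _); apply: eq_bigr => i _.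
  by rewrite !row_mxEl.
by rewrite !row_mxEr.
Qed.

Lemma enorm_row_mx_le x y : enorm (row_mx x y) <= enorm x + enorm y.
Proof.
rewrite -(ler_pXn2r (ltn0Sn 1)) ?nnegrE ?addr_ge0 ?enorm_ge0 //.
rewrite enorm_sqr dot_row_mx -!enorm_sqr.
have := enorm_ge0 x; have := enorm_ge0 y; nra.
Qed.

Lemma enorm_row_mx_gel x y : enorm x <= enorm (row_mx x y).
Proof. by apply: ler_wsqrtr; rewrite dot_row_mx lerDl dotvv_ge0. Qed.

Lemma enorm_row_mx_ger x y : enorm y <= enorm (row_mx x y).
Proof. by apply: ler_wsqrtr; rewrite dot_row_mx lerDr dotvv_ge0. Qed.

Lemma flat_row_mx G x y : flat G (row_mx x y) <-> G (x, y).
Proof.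
split; last by move=> xy; exists (x, y).
by case=> -[x' y'] /= Gxy /eq_row_mx[<- <-].
Qed.

(** The product norm is traded for the equivalent sum of the two norms, at the price of a factor 2
    in [d] one way and in [e] the other way. *)
Lemma regular_normal_coneP G x y z w :
  regular_normal_cone (flat G) (row_mx x y) (row_mx z (- w)) <->
  G (x, y) /\ forall e, 0 < e -> exists2 d, 0 < d & forall x' y',
    G (x', y') -> eball x d x' -> eball y d y' ->
    dot z (x' - x) - dot w (y' - y) <= e * (enorm (x' - x) + enorm (y' - y)).
Proof.
have indN (p : 'rV[R]_(n + n)) : indicator (flat G) p != -oo%E.
  by rewrite /indicator; case: ifP.
have dom_ind (p : 'rV[R]_(n + n)) : dom (indicator (flat G)) p <-> flat G p.
  rewrite /dom /= /indicator; split; last by move=> ?; rewrite mem_set.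
  by case: ifP => // /set_mem.
have rowB x' y' : row_mx x' y' - row_mx x y = row_mx (x' - x) (y' - y).
  by rewrite opp_row_mx add_row_mx.
split=> [/regular_subdiffP-/(_ indN)[/dom_ind xyG H]|[xyG H]].
- split=> [|e e0]; first exact/flat_row_mx.
  have [d d0 dV] := H _ e0; exists (d / 2); first by rewrite divr_gt0.
  move=> x' y' G' xd yd; have := dV (row_mx x' y').
  rewrite /eball /= rowB /indicator !mem_set //; last exact/flat_row_mx.
  rewrite add0e lee_fin dot_row_mx dotNl.
  have := enorm_row_mx_le (x' - x) (y' - y).
  move: xd yd; rewrite /eball /= => xd yd xyN /(_ _).
  by move=> -/(_ ltac:(lra)); nra.
- apply/regular_subdiffP => //; split; first exact/dom_ind/flat_row_mx.
  move=> e e0; have e2 : 0 < e / 2 by rewrite divr_gt0.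
  have [d d0 dV] := H _ e2; exists d => // p pd.
  rewrite /indicator (mem_set ((flat_row_mx G x y).2 xyG)).
  case: ifPn => [/set_mem|_]; last by rewrite leey.
  case=> -[x' y'] /= G' pE; move: pd; rewrite /eball /= -pE rowB => pd.
  rewrite add0e lee_fin dot_row_mx dotNl.
  have xl := enorm_row_mx_gel (x' - x) (y' - y).
  have yr := enorm_row_mx_ger (x' - x) (y' - y).
  have := dV _ _ G' (le_trans xl pd) (le_trans yr pd); nra.
Qed.

End NormalCones.

(** * Proximal points *)

Section ProximalPoints.
Context {R : realType} {n : nat}.
Implicit Types (phi psi h : 'rV[R]_n -> \bar R) (u v w x y : 'rV[R]_n).

(** The sublevel sets [h <= h y] in [K] are nested, hence generate a filter. A cluster point of it
    is a minimizer, for otherwise [h] would exceed some [h y] around it. *)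
Lemma lsc_compact_min (K : set 'rV[R]_n) h : compact K -> K !=set0 ->
  (forall x, h x != -oo%E) ->
  (forall x a, K x -> (a%:E < h x)%E ->
     exists2 V, nbhs x V & forall y, V y -> K y -> (a%:E < h y)%E) ->
  exists2 x, K x & forall y, K y -> (h x <= h y)%E.
Proof.
move=> cK [x0 Kx0] hN lsch.
pose F := filter_from K (fun y => [set x | K x /\ (h x <= h y)%E]).
have FF : ProperFilter F.
  apply: filter_from_proper; last by move=> y Ky; exists y.
  apply: filter_from_filter; first by exists x0.
  move=> y1 y2 K1 K2; have [h12|/ltW h21] := leP (h y1) (h y2).
    by exists y1 => // x [Kx hx]; split; split=> //; apply: le_trans h12.
  by exists y2 => // x [Kx hx]; split; split=> //; apply: le_trans h21.
have FK : F K by exists x0 => // x [].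
have [x [Kx clx]] := cK F FF FK; exists x => // y Ky.
rewrite leNgt; apply/negP => yx.
have yE : h y = (fine (h y))%:E.
  by case: (h y) (hN y) yx => // _; rewrite ltNge leey.
rewrite yE in yx; have [V xV Vlt] := lsch _ _ Kx yx.
have Fy : F [set z | K z /\ (h z <= h y)%E] by exists y.
have [z [[Kz zy] Vz]] := clx _ _ Fy xV.
by have := Vlt _ Vz Kz; rewrite -yE ltNge zy.
Qed.

Lemma lsc_addr_continuous phi (c : 'rV[R]_n -> R) : (forall x, phi x != -oo%E) ->
  lower_semicontinuous phi -> continuous c ->
  lower_semicontinuous (fun x => phi x + (c x)%:E)%E.
Proof.
move=> phiN lsc cc x a ax.
have [b ab bx] : exists2 b, a - c x < b & (b%:E < phi x)%E.
  case: (phi x) (phiN x) ax => [p _| _ _ |//]; last first.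
    by exists (a - c x + 1); rewrite ?ltry // ltrDl.
  rewrite -EFinD lte_fin => ap; exists ((a - c x + p) / 2); rewrite ?lte_fin; lra.
have [V xV Vb] := lsc _ _ bx.
have xW : nbhs x (c @^-1` [set s | a - b < s]).
  by apply: cc; apply: lt_nbhsr; lra.
exists (V `&` c @^-1` [set s | a - b < s]); first exact: filterI.
move=> y [Vy /= cy]; have := Vb _ Vy; case: (phi y) (phiN y) => [q _|_ _|//].
  by rewrite -EFinD !lte_fin; lra.
by rewrite ltry.
Qed.

(* [y = (r + 1) u + v] says that [u] minimises
   [phi x + (r + 1) / 2 |x|^2 - <y, x>]; the shift makes this function strongly
   convex as seen from [xb], so for [y] near [(r + 1) xb + vb] the minimum over
   the ball is attained in its interior. *)
Lemma proximal_point phi xb vb (eps r : R) y : (forall x, phi x != -oo%E) ->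
  lower_semicontinuous phi -> dom phi xb -> 0 <= r ->
  (forall x, eball xb eps x ->
    (phi xb + (dot vb (x - xb) - r / 2 * enorm (x - xb) ^+ 2)%:E <= phi x)%E) ->
  2 * enorm (y - ((r + 1) *: xb + vb)) < eps ->
  exists u v, [/\ regular_subdiff phi u v, y = (r + 1) *: u + v &
    enorm (u - xb) <= 2 * enorm (y - ((r + 1) *: xb + vb))].
Proof.
move=> phiN lsc xbdom r0 prox ye.
set N := enorm (y - _) in ye *; have N0 : 0 <= N := enorm_ge0 _.
have eps0 : 0 < eps by apply: le_lt_trans ye; rewrite mulr_ge0.
pose c x := (r + 1) / 2 * dot x x - dot y x.
have cc : continuous c.
  suff cvgc (F : set_system 'rV[R]_n) (FF : Filter F) x :
    id @ F --> x -> c @ F --> c x by move=> x; apply: (cvgc _ (nbhs_filter x)).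
  move=> Fx; apply: cvgB; last by apply: cvg_dot => //; exact: cvg_cst.
  by apply: cvgM; [exact: cvg_cst|exact: cvg_dot].
have hN x : (phi x + (c x)%:E != -oo)%E.
  by case: (phi x) (phiN x).
have [u ux umin] : exists2 u, eball xb eps u &
    forall z, eball xb eps z -> (phi u + (c u)%:E <= phi z + (c z)%:E)%E.
  apply: lsc_compact_min => //; first exact: eball_compact.
    by exists xb; apply: eball_center; exact: ltW.
  move=> x a _ ax; have [V xV Va] := lsc_addr_continuous phiN lsc cc ax.
  by exists V => // z /Va.
have xbE := dom_fin (phiN _) xbdom.
have xbb : eball xb eps xb by apply: eball_center; exact: ltW.
have uE : phi u = (fine (phi u))%:E.
  by have := umin _ xbb; rewrite xbE; case: (phi u) (phiN u).
have uN : enorm (u - xb) <= 2 * N.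
  (* Adding the minimality of [u] against [xb] to the support inequality at [xb] gives
     [e ^ 2 <= 2 N e]. *)
  have := umin _ xbb; have := prox _ ux; rewrite uE xbE -!EFinD !lee_fin /c.
  have E : dot u u - dot xb xb = 2 * dot xb (u - xb) + dot (u - xb) (u - xb).
    by rewrite !dotE (dotC u xb); ring.
  have E2 : dot (y - ((r + 1) *: xb + vb)) (u - xb) =
     dot y u - dot y xb - (r + 1) * dot xb (u - xb) - dot vb (u - xb).
    by rewrite !dotE; ring.
  have := dot_le_enorm (y - ((r + 1) *: xb + vb)) (u - xb); rewrite -/N.
  move: E; rewrite -(enorm_sqr (u - xb)); have := enorm_ge0 (u - xb).
  move: E2; set e := enorm (u - xb) => E2 e0 E L H1 H2.
  have H : e ^+ 2 <= 2 * N * e by nra.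
  have [->|en] := eqVneq e 0; first lra.
  by rewrite -(@ler_pM2r _ e) -?expr2 // lt_neqAle eq_sym en.
exists u, (y - (r + 1) *: u); split => //; last by rewrite addrC subrK.
(* As [u] is interior, its minimality on a ball around it becomes a quadratic minorant of modulus
   [r + 1]. *)
have d0 : 0 < eps - enorm (u - xb) by lra.
apply: (@quad_regular_subdiff _ _ _ _ _ (r + 1) _ _ _ _ d0) => //.
- by rewrite /dom /= uE ltry.
- by rewrite addr_ge0.
move=> z zu; have := umin z; rewrite uE /eball /= => /(_ _).
have tri := enorm_tri u z xb; have {}zu : enorm (z - u) <= eps - enorm (u - xb) := zu.
move=> /(_ ltac:(lra)); case: (phi z) (phiN z) => [q _|_ _|//]; last by rewrite leey.
rewrite -!EFinD !lee_fin /c enorm_sqr !dotE (dotC z u); lra.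
Qed.

End ProximalPoints.

(** * A mean value inequality for regular supergradients *)

(** Over [N + 1] equal steps the increments add up to at most [C / (N + 1)], which tends to 0. *)
Lemma le_of_quadratic_increments {R : realType} (F : R -> R) (C : R) :
  (forall a b : R, 0 <= a -> a <= b -> b <= 1 -> F b - F a <= C * (b - a) ^+ 2) ->
  F 1 <= F 0.
Proof.
move=> HF; apply/ler_addgt0Pr => e e0.
have HN (N i : nat) : (i <= N.+1)%N ->
    F (i%:R / N.+1%:R) - F 0 <= i%:R * (C / N.+1%:R ^+ 2).
  have N0 : 0 < N.+1%:R :> R by rewrite ltr0n.
  elim: i => [_|i IH iN]; first by rewrite !mul0r subrr.
  have {}IH := IH (ltnW iN).
  have := HF (i%:R / N.+1%:R) (i.+1%:R / N.+1%:R).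
  rewrite -mulrBl -natrB // subSnn mul1r exprVn.
  rewrite divr_ge0 ?ler0n // ler_pM2r ?invr_gt0 // ler_nat leqnSn.
  rewrite ler_pdivrMr // mul1r ler_nat iN => /(_ isT isT isT).
  move=> /lerD/(_ IH); rewrite subrKA => /le_trans; apply.
  by rewrite -[in leRHS]natr1 [in leRHS]mulrDl mul1r addrC.
pose N := Num.bound (`|C| / e); have N0 : 0 < N.+1%:R :> R by rewrite ltr0n.
have := HN N N.+1 (leqnn _); rewrite divff ?gt_eqF // expr2 invfM.
have -> : N.+1%:R * (C * (N.+1%:R^-1 * N.+1%:R^-1)) = C / N.+1%:R.
  by field; rewrite gt_eqF.
suff ce : C / N.+1%:R <= e by move=> Fc; rewrite -lerBlDl; exact: le_trans ce.
rewrite ler_pdivrMr //; apply: le_trans (ler_norm _) _.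
rewrite mulrC -ler_pdivrMr //.
have := archi_boundP (divr_ge0 (normr_ge0 C) (ltW e0)).
rewrite -/N => /ltW/le_trans; apply.
by rewrite ler_nat.
Qed.

(* A positive maximum of [g - g x - K |. - x| - C |. - x|^2] over the ball of
   radius [delta / 4] would be interior, because of the choice of [C], and
   different from [x]; there the penalty has a gradient of norm [> K]. *)
Lemma penalized_increment_le {R : realType} {n : nat}
    (g : 'rV[R]_n -> R) (yb : 'rV[R]_n) (delta L K : R) :
  0 < delta -> 0 < L -> 0 <= K ->
  (forall y z, eball yb delta y -> eball yb delta z ->
     g z - g y <= L * enorm (z - y)) ->
  (forall (y c : 'rV[R]_n), enorm (y - yb) < delta ->
     (forall e : R, 0 < e -> exists2 d : R, 0 < d & forall z, eball y d z ->
        g z - g y <= dot c (z - y) + e * enorm (z - y)) ->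
     enorm c <= K) ->
  forall x z, eball yb (delta / 2) x -> eball yb delta z ->
  g z - g x <= K * enorm (z - x) + L / (delta / 4) * enorm (z - x) ^+ 2.
Proof.
move=> delta0 L0 K0 g_lip g_supergradient x z xyb zyb; set C := L / (delta / 4).
have C0 : 0 < C by rewrite !divr_gt0.
have CL : C * (delta / 4) = L by rewrite /C; field; rewrite gt_eqF.
have xd : eball yb delta x by apply: eballS xyb; lra.
(* Far from [x] the Lipschitz bound suffices, since [C |z - x| >= L] there. *)
have [far|near] := ltP (delta / 4) (enorm (z - x)).
  have := g_lip _ _ xd zyb; have := mulr_ge0 K0 (enorm_ge0 (z - x)).
  have : 0 <= C * enorm (z - x) * (enorm (z - x) - delta / 4).
    by rewrite mulr_ge0 ?subr_ge0 ?(ltW far) // mulr_ge0 ?enorm_ge0 // ltW.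
  rewrite mulrBr -(mulrA _ (enorm _)) -(mulrA C) (mulrC (enorm _) (delta / 4)).
  rewrite (mulrA C (delta / 4)) CL; lra.
pose m y := K * enorm (y - x) + C * enorm (y - x) ^+ 2 - (g y - g x).
have in_ball y : eball x (delta / 4) y -> enorm (y - yb) < delta.
  move: xyb; rewrite /eball /= => ? ?; have := enorm_tri x y yb; lra.
have in_ballW y : eball x (delta / 4) y -> eball yb delta y.
  by move=> /in_ball/ltW.
have [y yx ymin] : exists2 y, eball x (delta / 4) y &
    forall z, eball x (delta / 4) z -> ((m y)%:E <= (m z)%:E)%E.
  apply: lsc_compact_min => //; first exact: eball_compact.
    by exists x; apply: eball_center; lra.
  move=> y a yx; rewrite lte_fin => am.
  (* [M] exceeds the Lipschitz constant [K + 3 L] of [m] on the ball. *)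
  pose M := K + 3 * L + 1; have M0 : 0 < M by rewrite /M; lra.
  exists (eball y ((m y - a) / (2 * M))); first by apply/nbhs_eball/divr_gt0; lra.
  move=> w wy wx; rewrite lte_fin.
  have := g_lip _ _ (in_ballW _ yx) (in_ballW _ wx).
  have := enorm_tri w y x; rewrite (enormBC y w).
  have yx' : enorm (y - x) <= delta / 4 := yx.
  have wx' : enorm (w - x) <= delta / 4 := wx.
  move: wy; rewrite /eball /= ler_pdivlMr ?mulr_gt0 // => wy tri glip.
  have w0 := enorm_ge0 (w - y); have wx0 := enorm_ge0 (w - x).
  have y0 := enorm_ge0 (y - x).
  have H1 : K * enorm (y - x) <= K * enorm (w - x) + K * enorm (w - y) by nra.
  have H2 : C * enorm (y - x) ^+ 2 - C * enorm (w - x) ^+ 2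
      <= C * (delta / 4) * 2 * enorm (w - y).
    have [?|?] := leP (enorm (y - x)) (enorm (w - x)).
      have ? : enorm (y - x) ^+ 2 <= enorm (w - x) ^+ 2 by rewrite ler_pXn2r.
      have : 0 <= C * (delta / 4) * 2 * enorm (w - y) by rewrite CL; nra.
      nra.
    have H : enorm (y - x) ^+ 2 - enorm (w - x) ^+ 2 <= delta / 4 * 2 * enorm (w - y).
      have : enorm (y - x) - enorm (w - x) <= enorm (w - y) by lra.
      rewrite subr_sqr; nra.
    have -> : C * (delta / 4) * 2 * enorm (w - y) = C * (delta / 4 * 2 * enorm (w - y)).
      by ring.
    by rewrite -mulrBr ler_pM2l.
  rewrite CL in H2; move: am wy; rewrite /m /M; nra.
have {}ymin w (wx : eball x (delta / 4) w) : m y <= m w.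
  by rewrite -lee_fin ymin.
suff : 0 <= m y by have := ymin _ near; rewrite /m; lra.
rewrite leNgt; apply/negP => my0.
set s := enorm (y - x).
have s0 : 0 < s.
  rewrite lt_neqAle enorm_ge0 andbT eq_sym; apply/eqP => /enorm_eq0/eqP.
  rewrite subr_eq0 => /eqP yE; move: my0; rewrite yE /m !subrr enorm0; lra.
(* On the sphere [C s ^ 2 = L s] absorbs the increment of [g], so [m y] could not be negative. *)
have sR : s < delta / 4.
  rewrite lt_neqAle [s <= _]yx andbT; apply/eqP => sE.
  have := g_lip _ _ xd (in_ballW _ yx); move: my0; rewrite /m -/s.
  have := mulr_ge0 K0 (ltW s0); have : C * s ^+ 2 = L * s by rewrite expr2 mulrA sE CL.
  lra.
(* This vector is the gradient of the penalty at the minimizer [y] of [m], hence a regular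
   supergradient of [g]; its norm [K + 2 C s] contradicts the bound [K]. *)
have : enorm ((K / s + 2 * C) *: (y - x)) <= K.
  apply: (g_supergradient _ _ (in_ball _ yx)) => e e0.
  pose D := K / s / 2 + C.
  have D0 : 0 < D by rewrite ltr_wpDl // !divr_ge0 ?(ltW s0).
  exists (Num.min (delta / 4 - s) (e / D)).
    by rewrite lt_min divr_gt0 // andbT; lra.
  move=> w; rewrite /eball /= le_min => /andP[wyR wye].
  have wx : eball x (delta / 4) w.
    by rewrite /eball /=; have := enorm_tri y w x; rewrite -/s; lra.
  have := ymin _ wx; rewrite /m -/s.
  have E : enorm (w - x) ^+ 2 = s ^+ 2 + 2 * dot (y - x) (w - y) + enorm (w - y) ^+ 2.
    by rewrite !enorm_sqr !dotE !(dotC _ y) !(dotC _ x); ring.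
  (* AM-GM: [2 s |w - x| <= s ^ 2 + |w - x| ^ 2] *)
  have AG : enorm (w - x) <= s + dot (y - x) (w - y) / s + enorm (w - y) ^+ 2 / s / 2.
    have -> : s + dot (y - x) (w - y) / s + enorm (w - y) ^+ 2 / s / 2 =
        (s ^+ 2 + enorm (w - x) ^+ 2) / (2 * s).
      by rewrite E; field; rewrite gt_eqF.
    rewrite ler_pdivlMr ?mulr_gt0 //; have := sqr_ge0 (s - enorm (w - x)); nra.
  have {}AG : K * enorm (w - x) <=
      K * (s + dot (y - x) (w - y) / s + enorm (w - y) ^+ 2 / s / 2) by rewrite ler_wpM2l.
  rewrite E dotZl; move: wye; rewrite ler_pdivlMr // => wye mm.
  have : D * enorm (w - y) ^+ 2 <= e * enorm (w - y).
    by rewrite expr2 mulrA ler_wpM2r ?enorm_ge0 // mulrC.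
  move: AG mm; rewrite /D.
  by move: (s^-1) (enorm (w - x)) (enorm (w - y)) => i a b; lra.
rewrite enormZ -/s ger0_norm; last first.
  by rewrite addr_ge0 //; [rewrite divr_ge0 // ltW|rewrite mulr_ge0 // ltW].
rewrite mulrDl divfK ?gt_eqF //; nra.
Qed.

(** Along the segment [penalized_increment_le] gives slope [K] up to a quadratic error, which
    [le_of_quadratic_increments] removes. *)
Lemma supergradient_lipschitz {R : realType} {n : nat}
    (g : 'rV[R]_n -> R) (yb : 'rV[R]_n) (delta L K : R) :
  0 < delta -> 0 < L -> 0 <= K ->
  (forall y z, eball yb delta y -> eball yb delta z ->
     g z - g y <= L * enorm (z - y)) ->
  (forall (y c : 'rV[R]_n), enorm (y - yb) < delta ->
     (forall e : R, 0 < e -> exists2 d : R, 0 < d & forall z, eball y d z ->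
        g z - g y <= dot c (z - y) + e * enorm (z - y)) ->
     enorm c <= K) ->
  forall x z, eball yb (delta / 2) x -> eball yb (delta / 2) z ->
  g z - g x <= K * enorm (z - x).
Proof.
move=> delta0 L0 K0 g_lip g_sup y z yb2 zb2; pose p t := t *: z + (1 - t) *: y.
have pb t : 0 <= t -> t <= 1 -> eball yb (delta / 2) (p t).
  by move=> t0 t1; apply: eball_convex.
have pB a b : p b - p a = (b - a) *: (z - y).
  by apply/rowP => i; rewrite !mxE; ring.
have := @le_of_quadratic_increments _
  (fun t => g (p t) - t * (K * enorm (z - y))) (L / (delta / 4) * enorm (z - y) ^+ 2).
have -> : p 1 = z by rewrite /p subrr scale0r addr0 scale1r.
have -> : p 0 = y by rewrite /p subr0 scale0r add0r scale1r.
move=> H; suff : g z - 1 * (K * enorm (z - y)) <= g y - 0 * (K * enorm (z - y)) by lra.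
apply: H => a b a0 ab b1.
have pa := pb a a0 ltac:(lra).
have := penalized_increment_le delta0 L0 K0 g_lip g_sup (x := p a) (z := p b) pa
  (eballS _ (pb b ltac:(lra) b1)).
rewrite pB enormZ ger0_norm ?subr_ge0 //.
move=> /(_ ltac:(lra)); rewrite exprMn; lra.
Qed.

(** * Monotonicity of the localised graph *)

Section LocalGraph.
Context {R : realType} {n : nat}.
Implicit Types (phi psi : 'rV[R]_n -> \bar R) (u v w x y xb vb : 'rV[R]_n).
Implicit Types (eps r eta : R).

(** No bound on [phi u] is imposed: subdifferential continuity supplies it once [eps] is small. *)
Definition local_graph phi xb vb eps u v : Prop :=
  [/\ limiting_subdiff phi u v, eball xb eps u & eball vb eps v].

Definition prox_on phi xb vb eps r : Prop :=
  forall u v x, local_graph phi xb vb eps u v -> eball xb eps x ->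
    (phi u + (dot v (x - u) - r / 2 * enorm (x - u) ^+ 2)%:E <= phi x)%E.

Definition positive_on phi xb vb eps : Prop :=
  forall x y w z, local_graph phi xb vb eps x y ->
    combined_subdiff2 phi x y w z -> 0 <= dot z w.

Lemma limiting_fin phi u v : (forall x, phi x != -oo%E) ->
  limiting_subdiff phi u v -> phi u = (fine (phi u))%:E.
Proof. by move=> phiN [udom _]; exact: dom_fin. Qed.

(** Adding the two prox-regularity inequalities gives [<v' - v, u' - u> >= - r |u' - u| ^ 2]; the
    shift by [r + 1] makes the resolvent firmly nonexpansive. *)
Lemma local_firm phi xb vb eps r u v u' v' : (forall x, phi x != -oo%E) ->
  prox_on phi xb vb eps r ->
  local_graph phi xb vb eps u v -> local_graph phi xb vb eps u' v' ->
  enorm (u' - u) ^+ 2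
    <= dot (((r + 1) *: u' + v') - ((r + 1) *: u + v)) (u' - u).
Proof.
move=> phiN prox T T'; case: (T) => uv ub _; case: (T') => uv' ub' _.
have := prox _ _ _ T ub'; have := prox _ _ _ T' ub.
rewrite (limiting_fin phiN uv) (limiting_fin phiN uv') -!EFinD !lee_fin.
rewrite (enormBC u u') !enorm_sqr !dotE (dotC u u') (dotC v' u) (dotC v' u').
rewrite (dotC v u) (dotC v u'); lra.
Qed.

Lemma local_nonexpansive phi xb vb eps r u v u' v' : (forall x, phi x != -oo%E) ->
  prox_on phi xb vb eps r ->
  local_graph phi xb vb eps u v -> local_graph phi xb vb eps u' v' ->
  enorm (u' - u) <= enorm (((r + 1) *: u' + v') - ((r + 1) *: u + v)).
Proof.
move=> phiN prox T T'.
have := le_trans (local_firm phiN prox T T') (dot_le_enorm _ _).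
have [->|u0] := eqVneq (enorm (u' - u)) 0; first by rewrite enorm_ge0.
by rewrite expr2 ler_pM2r // lt_neqAle enorm_ge0 eq_sym u0.
Qed.

Lemma local_inj phi xb vb eps r u v u' v' : (forall x, phi x != -oo%E) ->
  prox_on phi xb vb eps r ->
  local_graph phi xb vb eps u v -> local_graph phi xb vb eps u' v' ->
  (r + 1) *: u' + v' = (r + 1) *: u + v -> u' = u.
Proof.
move=> phiN prox T T' E; have := local_nonexpansive phiN prox T T'.
rewrite E subrr enorm0 => H; apply/eqP; rewrite -subr_eq0; apply/eqP/enorm_eq0.
by apply/eqP; rewrite eq_le H enorm_ge0.
Qed.

(** Proximal points provide [u] with [|u - xb| <= 2 N]; then [|v - vb| <= N + (r + 1) 2 N], whence
    the factor [2 (r + 2)]. *)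
Lemma local_param phi xb vb eps r : (forall x, phi x != -oo%E) ->
  lower_semicontinuous phi -> limiting_subdiff phi xb vb -> 0 < eps -> 0 <= r ->
  prox_on phi xb vb eps r ->
  forall y, enorm (y - ((r + 1) *: xb + vb)) <= eps / (4 * (r + 2)) ->
  exists u v, [/\ limiting_subdiff phi u v, y = (r + 1) *: u + v,
    enorm (u - xb) <= 2 * (r + 2) * enorm (y - ((r + 1) *: xb + vb)) &
    enorm (v - vb) <= 2 * (r + 2) * enorm (y - ((r + 1) *: xb + vb))].
Proof.
move=> phiN lsc xv eps0 r0 prox y.
set N := enorm (y - _); have N0 : 0 <= N := enorm_ge0 _.
rewrite ler_pdivlMr; last lra.
move=> Neps.
have Txb : local_graph phi xb vb eps xb vb.
  by split=> //; apply: eball_center; exact: ltW.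
have [u [v [uv yE uN]]] : exists u v, [/\ regular_subdiff phi u v,
    y = (r + 1) *: u + v & enorm (u - xb) <= 2 * N].
  apply: (@proximal_point _ _ _ _ _ eps) => //; first by case: xv.
    by move=> x xxb; exact: prox.
  rewrite -/N; nra.
exists u, v; split=> //; first exact: regular_limiting.
  nra.
have -> : v - vb = (y - ((r + 1) *: xb + vb)) - (r + 1) *: (u - xb).
  by rewrite yE; apply/rowP => i; rewrite !mxE; ring.
apply: le_trans (enormB _ _) _; rewrite enormZ ger0_norm ?addr_ge0 // -/N; nra.
Qed.

(** The pairs are kept in half the radius, so that graph points close to them still lie in the local
    graph of radius [eps]. *)
Lemma local_param_fun phi xb vb eps r : (forall x, phi x != -oo%E) ->
  lower_semicontinuous phi -> limiting_subdiff phi xb vb -> 0 < eps -> 0 <= r ->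
  prox_on phi xb vb eps r ->
  exists P : 'rV[R]_n -> 'rV[R]_n,
    forall y, enorm (y - ((r + 1) *: xb + vb)) <= eps / (4 * (r + 2)) ->
      local_graph phi xb vb (eps / 2) (P y) (y - (r + 1) *: P y).
Proof.
move=> phiN lsc xv eps0 r0 prox.
suff /choice[P HP] : forall y, exists u,
    enorm (y - ((r + 1) *: xb + vb)) <= eps / (4 * (r + 2)) ->
      local_graph phi xb vb (eps / 2) u (y - (r + 1) *: u) by exists P.
move=> y.
have [yN|yN] := leP (enorm (y - ((r + 1) *: xb + vb))) (eps / (4 * (r + 2))); last first.
  by exists 0.
have [u [v [uv yE uN vN]]] := local_param phiN lsc xv eps0 r0 prox yN.
move: yN; rewrite ler_pdivlMr => [yN|]; last lra.
exists u => _; have -> : y - (r + 1) *: u = v by rewrite yE addrC addKr.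
by split=> //; rewrite /eball /=; lra.
Qed.

Lemma local_graphS phi xb vb eps eps' u v : eps <= eps' ->
  local_graph phi xb vb eps u v -> local_graph phi xb vb eps' u v.
Proof. by move=> e [uv ux vx]; split=> //; apply: eballS e _ _. Qed.

(* With [P] the localised resolvent, a regular supergradient [c] of
   [<a, 2 (r + 1) P - id>] at [y] is the same as a regular normal to the graph
   of the subdifferential, and positivity then reads [|c| <= |a|].  Hence
   [2 (r + 1) P - id] is nonexpansive, which is monotonicity of the graph. *)
Lemma local_monotone phi xb vb eps r u v u' v' : (forall x, phi x != -oo%E) ->
  lower_semicontinuous phi -> limiting_subdiff phi xb vb -> 0 < eps -> 0 <= r ->
  prox_on phi xb vb eps r -> positive_on phi xb vb eps ->
  local_graph phi xb vb eps u v -> local_graph phi xb vb eps u' v' ->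
  enorm ((r + 1) *: u + v - ((r + 1) *: xb + vb)) <= eps / (4 * (r + 2)) / 2 ->
  enorm ((r + 1) *: u' + v' - ((r + 1) *: xb + vb)) <= eps / (4 * (r + 2)) / 2 ->
  0 <= dot (v' - v) (u' - u).
Proof.
move=> phiN lsc xv eps0 r0 prox pos T T'.
have [P HP] := local_param_fun phiN lsc xv eps0 r0 prox.
set delta := eps / _ in HP *; set yb := _ + vb in HP *.
have delta0 : 0 < delta by rewrite divr_gt0 // mulr_gt0 //; lra.
set y := _ + v; set y' := _ + v' => yN yN'.
have HP' z : eball yb delta z -> local_graph phi xb vb eps (P z) (z - (r + 1) *: P z).
  by move=> /HP; apply: local_graphS; lra.
have PE z u1 v1 : local_graph phi xb vb eps u1 v1 -> z = (r + 1) *: u1 + v1 ->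
    eball yb delta z -> P z = u1.
  move=> T1 zE zd; apply: (local_inj phiN prox T1 (HP' _ zd)).
  by rewrite addrC subrK.
have half z : enorm (z - yb) <= delta / 2 -> eball yb delta z.
  by move=> ?; rewrite /eball /=; lra.
have Py : P y = u by apply: (PE _ _ v) => //; exact: half.
have Py' : P y' = u' by apply: (PE _ _ v') => //; exact: half.
pose Q z := (2 * (r + 1)) *: P z - z.
have [a aE] : exists a, a = Q y' - Q y by exists (Q y' - Q y).
have a0 := enorm_ge0 a.
have P_lip z z' : eball yb delta z -> eball yb delta z' ->
    enorm (P z' - P z) <= enorm (z' - z).
  move=> zd zd'; have := local_nonexpansive phiN prox (HP' _ zd) (HP' _ zd').
  by rewrite !(addrC (_ *: _)) !subrK.
(* For [a = Q y' - Q y] the left side is [|a| ^ 2], so this yields [|a| <= |y' - y|]. *)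
have : dot a (Q y') - dot a (Q y) <= enorm a * enorm (y' - y).
  apply: (@supergradient_lipschitz _ _ (fun z => dot a (Q z)) yb delta
    ((2 * (r + 1) + 1) * (enorm a + 1))) => //.
  - by rewrite mulr_gt0 ?ltr_wpDl //; lra.
  - move=> z z' zd zd' /=; rewrite -dotNr -dotDr.
    apply: le_trans (dot_le_enorm _ _) _.
    have -> : Q z' - Q z = (2 * (r + 1)) *: (P z' - P z) - (z' - z).
      by apply/rowP => i; rewrite !mxE; ring.
    have := enormB ((2 * (r + 1)) *: (P z' - P z)) (z' - z).
    rewrite enormZ ger0_norm; last lra.
    have := P_lip _ _ zd zd'; have := enorm_ge0 (P z' - P z); have := enorm_ge0 (z' - z).
    set A := enorm (_ *: _ - _); set B := enorm (P z' - P z); set D := enorm (z' - z).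
    move=> D0 B0 BD AB.
    have AD : A <= (2 * (r + 1) + 1) * D by nra.
    have := enorm_ge0 ((2 * (r + 1)) *: (P z' - P z) - (z' - z)); rewrite -/A => A0.
    nra.
  move=> z c zd gc; set rho := r + 1; have rho1 : 1 <= rho by rewrite /rho; lra.
  have zdW : eball yb delta z by exact: ltW.
  have [_ Pzx zv] := HP _ zdW.
  (* The supergradient [c] corresponds to the regular normal [(a - rho b, - b)] at the graph point
     over [z]. *)
  have [b bE] : exists b, (2 * rho) *: b = c + a.
    by exists ((2 * rho)^-1 *: (c + a)); rewrite scalerA divff ?scale1r // gt_eqF //; lra.
  have : 0 <= dot (a - rho *: b) b.
    apply: (pos (P z) (z - rho *: P z)); first exact: HP'.
    apply/regular_normal_coneP; split; first by have [] := HP' _ zdW.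
    move=> e e0; have [d d0 dV] := gc _ e0.
    (* The second entry keeps [y1] in the ball where [P] is the resolvent. *)
    pose d1 := Num.min d (delta - enorm (z - yb)).
    have d10 : 0 < d1 by rewrite lt_min d0 subr_gt0.
    exists (Num.min (eps / 2) (d1 / (rho + 1))).
      by rewrite lt_min !divr_gt0 //; lra.
    move=> x1 v1 xv1; rewrite /eball /= !le_min => /andP[x1e x1d] /andP[v1e v1d].
    move: x1d v1d; rewrite !ler_pdivlMr ?ltr_wpDl //; try lra; move=> x1d v1d.
    have [y1 y1eq] : exists y1, y1 = rho *: x1 + v1 by eexists.
    have y1E : y1 - z = rho *: (x1 - P z) + (v1 - (z - rho *: P z)).
      by rewrite y1eq; apply/rowP => i; rewrite !mxE; ring.
    have y1N : enorm (y1 - z) <= rho * enorm (x1 - P z) + enorm (v1 - (z - rho *: P z)).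
      rewrite y1E; apply: le_trans (enormD _ _) _; rewrite enormZ ger0_norm //; lra.
    have y1z : enorm (y1 - z) <= d1.
      apply: le_trans y1N _.
      rewrite -(@ler_pM2r _ (rho + 1)); [nra|lra].
    move: y1z; rewrite le_min => /andP[y1d y1delta].
    have T1 : local_graph phi xb vb eps x1 v1.
      move: Pzx zv; rewrite /eball /= => Pzx zv; split=> //; rewrite /eball /=.
        by have := enorm_tri (P z) x1 xb; lra.
      by have := enorm_tri (z - rho *: P z) v1 vb; lra.
    have Py1 : P y1 = x1.
      apply: (PE _ _ v1) => //; rewrite /eball /=; have := enorm_tri z y1 yb; lra.
    have := dV _ y1d; rewrite /Q Py1 -/rho.
    have E : 2 * rho * (dot (a - rho *: b) (x1 - P z) - dot b (v1 - (z - rho *: P z))) =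
      dot a ((2 * rho) *: x1 - y1) - dot a ((2 * rho) *: P z - z) - dot c (y1 - z).
      have -> : v1 - (z - rho *: P z) = y1 - z - rho *: (x1 - P z).
        by rewrite y1E [RHS]addrC addKr.
      have cE : c = (2 * rho) *: b - a by rewrite bE addrK.
      by rewrite cE !dotE; ring.
    move=> H; rewrite -(@ler_pM2l _ (2 * rho)) ?E; last lra.
    have X0 := enorm_ge0 (x1 - P z); have V0 := enorm_ge0 (v1 - (z - rho *: P z)).
    apply: le_trans (_ : e * enorm (y1 - z) <= _); first lra.
    apply: le_trans
      (_ : e * (rho * enorm (x1 - P z) + enorm (v1 - (z - rho *: P z))) <= _).
      by rewrite ler_pM2l.
    rewrite mulrCA ler_pM2l //; nra.
  (* After multiplication by [4 rho] the product is [<a - c, a + c> = |a| ^ 2 - |c| ^ 2]. *)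
  rewrite -(@pmulr_rge0 _ (4 * rho)); last lra.
  have -> : 4 * rho * dot (a - rho *: b) b =
     dot (2 *: a - ((2 * rho) *: b)) ((2 * rho) *: b).
    by rewrite !dotE; ring.
  by rewrite bE !dotE (dotC c a) => H; apply: le_enorm; lra.
rewrite -dotNr -dotDr -aE -enorm_sqr => aN.
have {}aN : enorm a <= enorm (y' - y).
  have [->|an] := eqVneq (enorm a) 0; first exact: enorm_ge0.
  by move: aN; rewrite expr2 ler_pM2l // lt_neqAle a0 eq_sym an.
have : enorm a ^+ 2 <= enorm (y' - y) ^+ 2 by rewrite ler_pXn2r // nnegrE enorm_ge0.
rewrite !enorm_sqr.
(* The squared norms of the sum and the difference of [(r + 1) du] and [dv] differ by
   [4 (r + 1) <du, dv>]. *)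
have -> : a = (r + 1) *: (u' - u) - (v' - v).
  by rewrite aE /Q Py Py' /y /y'; apply/rowP => i; rewrite !mxE; ring.
have -> : y' - y = (r + 1) *: (u' - u) + (v' - v).
  by rewrite /y /y'; apply/rowP => i; rewrite !mxE; ring.
move: (u' - u) (v' - v) => du dv; rewrite !dotE (dotC du dv) => H.
by rewrite -(@pmulr_rge0 _ (4 * (r + 1))); lra.
Qed.

End LocalGraph.

(** * Supporting affine functions *)

Section Support.
Context {R : realType} {n : nat}.
Implicit Types (phi psi : 'rV[R]_n -> \bar R) (u v w x y xb vb : 'rV[R]_n).
Implicit Types (eps r eta : R).

(** The graph condition says that [u] is the proximal point of [phi - <v, .>] with center [s]; the
    weight [r + 1] outweighs the defect [r] of prox-regularity. *)
Lemma moreau_min phi xb vb eps r u v x p s : (forall x, phi x != -oo%E) -> 0 <= r ->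
  prox_on phi xb vb eps r -> local_graph phi xb vb eps u (v - (r + 1) *: (u - s)) ->
  eball xb eps p ->
  (phi u + ((r + 1) / 2 * dot (u - s) (u - s) - dot v (u - s))%:E
   <= phi p + ((r + 1) / 2 * dot (p - s) (p - s) - dot v (p - s))%:E)%E.
Proof.
move=> phiN r0 prox T pb; have := prox _ _ _ T pb.
have [/(limiting_fin phiN)-> _ _] := T.
case: (phi p) (phiN p) => [q _|_ _|//]; last by rewrite leey.
have -> : p - s = (p - u) + (u - s) by rewrite subrKA.
rewrite -!EFinD !lee_fin enorm_sqr; have := dotvv_ge0 (p - u).
move: (p - u) (u - s) => k h; rewrite !dotE (dotC k h); nra.
Qed.

(* The Moreau envelope [D t] of [phi - <v, .>] along the segment from [u] to
   [x] satisfies [D b >= D a + (b - a) <v, x - u> - C (b - a) ^ 2], because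
   monotonicity of the graph controls its gradient. *)
Lemma local_support phi xb vb eps r eta u v x : (forall x, phi x != -oo%E) ->
  lower_semicontinuous phi -> limiting_subdiff phi xb vb -> 0 < eps -> 0 <= r ->
  prox_on phi xb vb eps r -> positive_on phi xb vb eps ->
  eta <= eps -> (r + 2) * eta <= eps / (4 * (r + 2)) / 2 ->
  local_graph phi xb vb eta u v -> eball xb eta x ->
  (phi u + (dot v (x - u))%:E <= phi x)%E.
Proof.
move=> phiN lsc xv eps0 r0 prox pos eta_eps eta_delta T xeta.
have [P HP] := local_param_fun phiN lsc xv eps0 r0 prox.
have delta0 : 0 < eps / (4 * (r + 2)) by rewrite divr_gt0 // mulr_gt0 //; lra.
have T_eps := local_graphS eta_eps T; case: (T) => uv ueta veta.
pose s t := u + t *: (x - u).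
have sE t : s t = t *: x + (1 - t) *: u.
  by apply/rowP => i; rewrite !mxE; ring.
have y_near t : 0 <= t -> t <= 1 ->
    enorm ((r + 1) *: s t + v - ((r + 1) *: xb + vb)) <= eps / (4 * (r + 2)) / 2.
  move=> t0 t1; apply: le_trans eta_delta.
  have -> : (r + 1) *: s t + v - ((r + 1) *: xb + vb) = (r + 1) *: (s t - xb) + (v - vb).
    by apply/rowP => i; rewrite !mxE; ring.
  apply: le_trans (enormD _ _) _; rewrite enormZ ger0_norm ?addr_ge0 //.
  have : enorm (s t - xb) <= eta by rewrite sE; exact: (eball_convex t0 t1 xeta ueta).
  move: veta; rewrite /eball /=; nra.
(* [p t] is the proximal point with center [s t], so that [D t] below is the value of the envelope
   at [s t]. *)
pose p t := P ((r + 1) *: s t + v).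
have Tp t : 0 <= t -> t <= 1 ->
    local_graph phi xb vb eps (p t) (v - (r + 1) *: (p t - s t)).
  move=> t0 t1.
  have -> : v - (r + 1) *: (p t - s t) = (r + 1) *: s t + v - (r + 1) *: p t.
    by apply/rowP => i; rewrite !mxE; ring.
  have : local_graph phi xb vb (eps / 2) (p t) ((r + 1) *: s t + v - (r + 1) *: p t).
    by apply: HP; apply: le_trans (y_near t t0 t1) _; lra.
  by apply: local_graphS; lra.
have pfin t : 0 <= t -> t <= 1 -> phi (p t) = (fine (phi (p t)))%:E.
  by move=> t0 t1; have [] := Tp t t0 t1 => /(limiting_fin phiN).
have p0 : p 0 = u.
  apply: (local_inj phiN prox T_eps (Tp 0 (lexx _) ler01)).
  by rewrite /s; apply/rowP => i; rewrite !mxE; ring.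
pose D t := fine (phi (p t)) + (r + 1) / 2 * dot (p t - s t) (p t - s t)
  - dot v (p t - s t).
have s1 : s 1 = x by rewrite /s scale1r addrC subrK.
have D0 : D 0 = fine (phi u).
  by rewrite /D p0 /s scale0r addr0 subrr !dot0r mulr0 addr0 subr0.
have D1 : ((D 1)%:E <= phi x)%E.
  have := @moreau_min _ _ _ _ _ _ _ x x (s 1) phiN r0 prox
    (Tp 1 ler01 (lexx _)) (eballS eta_eps xeta).
  by rewrite pfin // s1 subrr !dot0r mulr0 subr0 adde0 -EFinD addrA /D s1.
suff H : 1 * dot v (x - u) - D 1 <= 0 * dot v (x - u) - D 0.
  rewrite (limiting_fin phiN uv); apply: le_trans D1.
  by rewrite -EFinD lee_fin -D0; lra.
apply: (@le_of_quadratic_increments _ (fun t => t * dot v (x - u) - D t)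
  ((r + 1) / 2 * dot (x - u) (x - u))) => a b a0 ab b1.
have b0 := le_trans a0 ab; have a1 := le_trans ab b1.
(* [p b] competes in the minimum at [s a]; monotonicity against [(u, v)] then settles the sign of
   the cross term. *)
have := @moreau_min _ _ _ _ _ _ _ x (p b) (s a) phiN r0 prox (Tp a a0 a1).
have [_ pb _] := Tp b b0 b1; move=> /(_ pb).
rewrite (pfin a) // (pfin b) // -!EFinD lee_fin => Dab.
have /= mono := local_monotone phiN lsc xv eps0 r0 prox pos T_eps (Tp b b0 b1).
have {mono} : 0 <= dot (v - (r + 1) *: (p b - s b) - v) (p b - u).
  apply: mono.
    by have := y_near 0 (lexx _) ler01; rewrite /s scale0r addr0.
  have -> : (r + 1) *: p b + (v - (r + 1) *: (p b - s b)) = (r + 1) *: s b + v.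
    by apply/rowP => i; rewrite !mxE; ring.
  exact: y_near.
rewrite /D; move: Dab.
have -> : p b - s a = (p b - s b) + (b - a) *: (x - u).
  by apply/rowP => i; rewrite !mxE; ring.
have -> : p b - u = (p b - s b) + b *: (x - u).
  by apply/rowP => i; rewrite !mxE; ring.
have -> : v - (r + 1) *: (p b - s b) - v = - (r + 1) *: (p b - s b).
  by apply/rowP => i; rewrite !mxE; ring.
move: (p b - s b) (x - u) (p a - s a) (fine _) (fine _) => q k q' fa fb.
rewrite !dotE (dotC k q) => Dab mono.
(* Monotonicity reads [<q, q + b k> <= 0], so [<q, k> <= 0] if [b > 0]; and [b = 0] forces
   [a = 0]. *)
have qk : (b - a) * dot q k <= 0.
  have := dotvv_ge0 q; have [bE|bp] := eqVneq b 0; last first.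
    have {}bp : 0 < b by rewrite lt_neqAle eq_sym bp.
    move=> q0.
    have bqk : dot q q + b * dot q k <= 0.
      by rewrite -oppr_ge0 -(@pmulr_rge0 _ (r + 1)); lra.
    have : dot q k <= 0 by rewrite -(@pmulr_rle0 _ b) //; lra.
    nra.
  have -> : a = 0 by lra.
  by rewrite bE subrr mul0r.
nra.
Qed.

End Support.

(** * Variational convexity *)

Section Equivalence.
Context {R : realType} {n : nat}.
Implicit Types (phi psi : 'rV[R]_n -> \bar R) (u v w x y xb vb : 'rV[R]_n).
Implicit Types (eps r eta : R).

Lemma lt_of_near phi x xb e : (forall y, phi y != -oo%E) -> dom phi xb ->
  (`|phi x - phi xb| < e%:E)%E -> (phi x < phi xb + e%:E)%E.
Proof.
move=> phiN /(dom_fin (phiN _))->.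
case: (phi x) (phiN x) => [p _|//|//].
by rewrite -EFinB -EFinD abse_EFin !lte_fin ltr_norml => /andP[_]; lra.
Qed.

Definition support_sup phi xb vb eta x : \bar R :=
  ereal_sup [set z | exists u v, local_graph phi xb vb eta u v /\
    z = (phi u + (dot v (x - u))%:E)%E].

Lemma le_support_sup phi xb vb eta u v x : local_graph phi xb vb eta u v ->
  (phi u + (dot v (x - u))%:E <= support_sup phi xb vb eta x)%E.
Proof. by move=> T; apply: ereal_sup_ubound; exists u, v. Qed.

Lemma support_sup_lsc phi xb vb eta : (forall y, phi y != -oo%E) ->
  lower_semicontinuous (support_sup phi xb vb eta).
Proof.
move=> phiN x a /ereal_sup_gt[_ [u [v [T ->]]]].
have [/(limiting_fin phiN) uE _ _] := T; rewrite uE -EFinD lte_fin => ax.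
set gap := fine (phi u) + dot v (x - u) - a; have gap0 : 0 < gap by rewrite subr_gt0.
have N1 : 0 < enorm v + 1 by rewrite ltr_wpDl ?enorm_ge0.
exists (eball x (gap / (2 * (enorm v + 1)))).
  by apply: nbhs_eball; rewrite divr_gt0 // mulr_gt0.
move=> y; rewrite /eball /= ler_pdivlMr ?mulr_gt0 // => yx.
apply: lt_le_trans (le_support_sup y T); rewrite uE -EFinD lte_fin.
have -> : y - u = (x - u) + (y - x) by rewrite [RHS]addrC subrKA.
rewrite dotDr; have := dot_ge_enorm v (y - x); have := enorm_ge0 (y - x).
by move: ax gap0 yx; rewrite /gap; have := enorm_ge0 v; nra.
Qed.

Lemma support_sup_convex phi xb vb eta : (forall y, phi y != -oo%E) ->
  convex_efun (support_sup phi xb vb eta).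
Proof.
move=> phiN x y t t0 t1; apply: ge_ereal_sup => _ [u [v [T ->]]].
have [/(limiting_fin phiN) uE _ _] := T.
have t0E : (0 <= t%:E)%E by rewrite lee_fin ltW.
have t1E : (0 <= (1 - t)%:E)%E by rewrite lee_fin subr_ge0 ltW.
apply: le_trans (leeD (lee_wpmul2l t0E (le_support_sup x T))
                      (lee_wpmul2l t1E (le_support_sup y T))).
rewrite uE -!EFinD lee_fin.
have -> : t *: x + (1 - t) *: y - u = t *: (x - u) + (1 - t) *: (y - u).
  by apply/rowP => i; rewrite !mxE; ring.
by rewrite !dotE; lra.
Qed.

(** By [local_support], [support_sup] agrees with [phi] along the local graph and inherits its
    subgradients. Conversely, the resolvent of [phi] meets every nearby subgradient pair of
    [support_sup]. *)
Lemma positive_variationally_convex phi xb vb : proper_fun phi ->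
  lower_semicontinuous phi -> limiting_subdiff phi xb vb ->
  subdiff_continuous phi xb vb -> prox_regular phi xb vb ->
  (exists U V : set 'rV[R]_n, [/\ nbhs xb U, nbhs vb V &
     forall x y w z, combined_subdiff2 phi x y w z ->
       (gph (limiting_subdiff phi) `&` (U `*` V)) (x, y) -> 0 <= dot z w]) ->
  variationally_convex phi xb vb.
Proof.
move=> [phiN _] lsc xv scont [eps0 [r [eps00 r0 prox]]].
case=> U0 [V0 [/nbhs_eballP[dU dU0 UU] /nbhs_eballP[dV dV0 VV] pos0]].
have xbdom : dom phi xb by case: xv.
have [dc dc0 cont] := scont _ eps00.
pose eps := Num.min (Num.min eps0 dc) (Num.min dU dV).
have eps_gt0 : 0 < eps by rewrite !lt_min eps00 dc0 dU0 dV0.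
have [[le0 lec] [leU leV]] : (eps <= eps0 /\ eps <= dc) /\ (eps <= dU /\ eps <= dV).
  by rewrite !ge_min !lexx !orbT.
have phi_lt u v eta : eta <= eps -> local_graph phi xb vb eta u v ->
    (phi u < phi xb + eps0%:E)%E.
  move=> le_eta [uv ux vx]; apply: lt_of_near => //; apply: (cont _ v).
  by split=> //; split; apply: eballS (le_trans le_eta lec) _ _.
have proxL : prox_on phi xb vb eps r.
  move=> u v x T xx; have [uv ux vx] := T.
  have := prox x u v (eballS le0 xx) _ (phi_lt u v eps (lexx _) T).
  rewrite EFinB addeA; apply; split=> //; split; exact: eballS le0 _ _.
have posL : positive_on phi xb vb eps.
  move=> x y w z [xy xx yy] zw; apply: (pos0 x y) => //; split=> //; split.
    by apply: UU; apply: eballS leU _ _.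
  by apply: VV; apply: eballS leV _ _.
have r2 : 0 < r + 2 by lra.
(* The two entries are the size conditions of [local_support]. *)
pose eta := Num.min eps (eps / (4 * (r + 2)) / 2 / (r + 2)).
have eta0 : 0 < eta by rewrite lt_min eps_gt0 !divr_gt0 ?mulr_gt0.
have eta_eps : eta <= eps by rewrite ge_min lexx.
have eta_delta : (r + 2) * eta <= eps / (4 * (r + 2)) / 2.
  by rewrite mulrC -ler_pdivlMr // ge_min lexx orbT.
have Txb : local_graph phi xb vb eta xb vb.
  by split=> //; apply: eball_center; exact: ltW.
have support u v x (T : local_graph phi xb vb eta u v) (xx : eball xb eta x) :=
  local_support phiN lsc xv eps_gt0 r0 proxL posL eta_eps eta_delta T xx.
pose psi := support_sup phi xb vb eta.
have psi_le x : eball xb eta x -> (psi x <= phi x)%E.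
  by move=> xx; apply: ge_ereal_sup => _ [u [v [T ->]]]; exact: support.
have psi_eq u v : local_graph phi xb vb eta u v -> psi u = phi u.
  move=> T; apply/eqP; rewrite eq_le psi_le; last by case: T.
  by have := le_support_sup u T; rewrite subrr dot0r adde0.
have psiN x : psi x != -oo%E.
  rewrite -ltNye; apply: lt_le_trans (le_support_sup x Txb).
  by rewrite (dom_fin (phiN _) xbdom) -EFinD ltNyr.
have psi_dom : dom psi xb by rewrite /dom /= (psi_eq _ _ Txb).
have psi_cvx := support_sup_convex xb vb eta phiN.
have psi_sub u v : local_graph phi xb vb eta u v -> limiting_subdiff psi u v.
  move=> T; apply: regular_limiting.
  have [[udom _] _ _] := T.
  apply: (@quad_regular_subdiff _ _ _ _ _ 0 1) => //.
    by rewrite /dom /= (psi_eq _ _ T).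
  by move=> y _; rewrite mul0r mul0r subr0 (psi_eq _ _ T) le_support_sup.
(* Passing to [y] costs a factor [r + 2] and [local_param] a factor [2 (r + 2)], so the resolvent
   pair stays within [eta]. *)
pose eta1 := eta / (4 * (r + 2) ^+ 2).
have eta10 : 0 < eta1 by rewrite divr_gt0 // mulr_gt0 // exprn_gt0.
have eta1E : 4 * (r + 2) ^+ 2 * eta1 = eta.
  by rewrite /eta1 mulrC divfK // gt_eqF // mulr_gt0 // exprn_gt0.
have eta1_eta : eta1 <= eta by nra.
have TU x v : eball xb eta1 x -> eball vb eta1 v -> limiting_subdiff phi x v ->
    local_graph phi xb vb eta x v.
  by move=> xx vv xv'; split=> //; apply: eballS eta1_eta _ _.
have sub_phi x v : eball xb eta1 x -> eball vb eta1 v -> limiting_subdiff psi x v ->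
    limiting_subdiff phi x v.
  move=> xx vv xv'; pose y := (r + 1) *: x + v.
  have yN : enorm (y - ((r + 1) *: xb + vb)) <= (r + 2) * eta1.
    have -> : y - ((r + 1) *: xb + vb) = (r + 1) *: (x - xb) + (v - vb).
      by rewrite /y; apply/rowP => i; rewrite !mxE; ring.
    apply: le_trans (enormD _ _) _; rewrite enormZ ger0_norm ?addr_ge0 //.
    by move: xx vv; rewrite /eball /=; nra.
  have yN' : enorm (y - ((r + 1) *: xb + vb)) <= eps / (4 * (r + 2)).
    apply: le_trans yN _; rewrite ler_pdivlMr ?mulr_gt0 //; nra.
  have [u' [v' [u'v' yE u'N v'N]]] := local_param phiN lsc xv eps_gt0 r0 proxL yN'.
  have bnd : 2 * (r + 2) * enorm (y - ((r + 1) *: xb + vb)) <= eta by nra.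
  have T' : local_graph phi xb vb eta u' v'.
    by split=> //; [exact: le_trans u'N bnd|exact: le_trans v'N bnd].
  (* [(x, v)] and [(u', v')] are subgradient pairs of [psi] with the same resolvent argument [y];
     adding their inequalities forces [u' = x]. *)
  have := convex_limiting_subdiff psiN psi_cvx xv' u'.
  have := convex_limiting_subdiff psiN psi_cvx (psi_sub _ _ T') x.
  rewrite (limiting_fin psiN xv') (limiting_fin psiN (psi_sub _ _ T')) -!EFinD !lee_fin.
  have v'E : v' = v - (r + 1) *: (u' - x).
    have -> : v' = y - (r + 1) *: u' by rewrite yE addrC addKr.
    by rewrite /y; apply/rowP => i; rewrite !mxE; ring.
  rewrite -(opprB u' x) v'E => H1 H2.
  have : (r + 1) * enorm (u' - x) ^+ 2 <= 0.
    rewrite enorm_sqr; move: H1 H2; move: (u' - x) => h; rewrite !dotE; lra.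
  rewrite pmulr_rle0; last lra.
  move=> H; have /enorm_eq0/eqP : enorm (u' - x) = 0.
    by apply/eqP; rewrite -sqrf_eq0 eq_le H sqr_ge0.
  rewrite subr_eq0 => /eqP u'x; move: u'v'.
  by rewrite v'E u'x subrr scaler0 subr0.
exists (eball xb eta1), (eball vb eta1), psi, eps0; split => //.
- by split; by [exact: nbhs_eball|exact: eball_convex_set].
- split=> //; [|exact: support_sup_lsc|].
    by split=> //; exists xb.
  by move=> x xx; apply: psi_le; exact: eballS eta1_eta _ _.
- apply/seteqP; split=> -[x v] /= [[xx vv] xv'].
    by case: xx => xx _; split=> //; apply: psi_sub; exact: TU.
  have xv2 := sub_phi _ _ xx vv xv'; split=> //; split=> //; split=> //.
  exact: phi_lt eta_eps (TU _ _ xx vv xv2).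
- move=> x v [[xx vv] xv']; apply/esym/(psi_eq _ v)/TU => //.
  exact: sub_phi.
Qed.

(* Moving along the resolvent of the subdifferential of [psi] in the direction
   [z - w] and testing the normal [(z, - w)] gives [|z - w| <= |z + w|]. *)
Lemma convex_normal_positive psi x y w z d : (forall u, psi u != -oo%E) ->
  lower_semicontinuous psi -> convex_efun psi -> limiting_subdiff psi x y -> 0 < d ->
  (forall e : R, 0 < e -> exists2 d1 : R, 0 < d1 & forall x' y',
     limiting_subdiff psi x' y' -> eball x d x' -> eball y d y' ->
     eball x d1 x' -> eball y d1 y' ->
     dot z (x' - x) - dot w (y' - y) <= e * (enorm (x' - x) + enorm (y' - y))) ->
  0 <= dot z w.
Proof.
move=> psiN lsc cvx xy d0 H.
suff zw : enorm (z - w) <= enorm (z + w).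
  have : enorm (z - w) ^+ 2 <= enorm (z + w) ^+ 2.
    by rewrite ler_pXn2r // nnegrE enorm_ge0.
  by rewrite !enorm_sqr !dotE (dotC w z); lra.
have [->|D0] := eqVneq (enorm (z - w)) 0; first exact: enorm_ge0.
have {}D0 : 0 < enorm (z - w) by rewrite lt_neqAle enorm_ge0 eq_sym D0.
(* As [|dx|] and [|dy|] will be at most [m], twice the error [e / 4 (|dx| + |dy|)] is at most
   [e m]. *)
apply/ler_addgt0Pr => e e0; have e4 : 0 < e / 4 by rewrite divr_gt0.
have [d1 d10 {}H] := H _ e4.
pose m := Num.min d1 d; have m0 : 0 < m by rewrite lt_min d10.
pose t := m / enorm (z - w); have t0 : 0 < t by rewrite divr_gt0.
have tm : t * enorm (z - w) = m by rewrite /t divfK // gt_eqF.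
have sub := convex_limiting_subdiff psiN cvx xy.
(* The support by [y] is global, so [r = 0] and any radius are allowed; [2 m + 1] leaves room for a
   step of length [m]. *)
have [x1 [y1 [/regular_limiting x1y1 E _]]] : exists x1 y1,
    [/\ regular_subdiff psi x1 y1,
      (0 + 1) *: x + y + t *: (z - w) = (0 + 1) *: x1 + y1 &
      enorm (x1 - x)
        <= 2 * enorm ((0 + 1) *: x + y + t *: (z - w) - ((0 + 1) *: x + y))].
  apply: (@proximal_point _ _ _ _ _ (2 * m + 1)) => //; first by case: xy.
    by move=> p _; rewrite mul0r mul0r subr0.
  by rewrite addrC addKr enormZ gtr0_norm // tm; lra.
have sub1 := convex_limiting_subdiff psiN cvx x1y1.
have mono : 0 <= dot (y1 - y) (x1 - x).
  have := sub x1; have := sub1 x.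
  rewrite (limiting_fin psiN xy) (limiting_fin psiN x1y1) -!EFinD !lee_fin.
  rewrite -(opprB x1 x) dotNr dotDl dotNl; lra.
have dxy : (x1 - x) + (y1 - y) = t *: (z - w).
  move: E; rewrite add0r !scale1r => E; rewrite addrACA -E.
  by apply/rowP => i; rewrite !mxE; ring.
have tN : enorm (t *: (z - w)) = m by rewrite enormZ gtr0_norm.
have := H x1 y1 x1y1.
have [dx0 dy0] := (dotvv_ge0 (x1 - x), dotvv_ge0 (y1 - y)).
move: tN dxy mono dx0 dy0; rewrite /eball /=.
move: (x1 - x) (y1 - y) => dx dy tN dxy mono dx0 dy0.
(* Since [<dx, dy> >= 0], the norms of [dx], [dy] and [dx - dy] are all at most [|dx + dy| = m]. *)
have leM (h : 'rV[R]_n) : dot h h <= dot (dx + dy) (dx + dy) -> enorm h <= m.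
  by move=> hM; rewrite -tN -dxy; exact: le_enorm.
have dxm : enorm dx <= m by apply: leM; rewrite !dotE (dotC dx dy); lra.
have dym : enorm dy <= m by apply: leM; rewrite !dotE (dotC dx dy); lra.
have dm : enorm (dx - dy) <= m by apply: leM; rewrite !dotE (dotC dx dy); lra.
have [md1 md] : m <= d1 /\ m <= d by rewrite !ge_min !lexx orbT.
move=> /(_ (le_trans dxm md) (le_trans dym md) (le_trans dxm md1) (le_trans dym md1)) K.
have I : 2 * (dot z dx - dot w dy) = t * enorm (z - w) ^+ 2 + dot (z + w) (dx - dy).
  have -> : t * enorm (z - w) ^+ 2 = dot (z - w) (dx + dy) by rewrite dxy dotZr enorm_sqr.
  by rewrite !dotE; ring.
have := dot_ge_enorm (z + w) (dx - dy); move: I; rewrite expr2 mulrA tm => I J.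
have : m * enorm (z - w) <= m * (enorm (z + w) + e).
  have := enorm_ge0 (z + w); nra.
by rewrite ler_pM2l.
Qed.

(** Subdifferential continuity puts nearby subgradient pairs over [Ueps], where the graph is that of
    the convex [psi]. Prox-regularity then holds with [r = 0], and normals can be tested on the
    graph of [psi]. *)
Lemma variationally_convex_positive phi xb vb : proper_fun phi ->
  limiting_subdiff phi xb vb -> subdiff_continuous phi xb vb ->
  variationally_convex phi xb vb ->
  prox_regular phi xb vb /\
  (exists U V : set 'rV[R]_n, [/\ nbhs xb U, nbhs vb V &
     forall x y w z, combined_subdiff2 phi x y w z ->
       (gph (limiting_subdiff phi) `&` (U `*` V)) (x, y) -> 0 <= dot z w]).
Proof.
move=> [phiN _] xv scont [U [V [psi [eps]]]] /=.
move=> [[/nbhs_eballP[dU dU0 UU] _ /nbhs_eballP[dV dV0 VV] _]].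
move=> [[psiN _] psi_lsc psi_cvx psi_le] eps0 gphE eqE.
have [dc dc0 cont] := scont _ eps0.
pose d := Num.min dc (Num.min dU dV).
have d0 : 0 < d by rewrite !lt_min dc0 dU0 dV0.
have [dc_d [dU_d dV_d]] : d <= dc /\ (d <= dU /\ d <= dV).
  by rewrite !ge_min !lexx !orbT.
have bU x : eball xb d x -> U x by move=> xx; apply: UU; exact: eballS dU_d _ xx.
have bV v : eball vb d v -> V v by move=> vv; apply: VV; exact: eballS dV_d _ vv.
have to_psi x v : eball xb d x -> eball vb d v -> limiting_subdiff phi x v ->
    limiting_subdiff psi x v /\ phi x = psi x.
  move=> xx vv xv'; have /[!gphE] G : ([set x | U x /\ (phi x < phi xb + eps%:E)%E] `*` V
      `&` gph (limiting_subdiff phi)) (x, v).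
    split=> //; split; last exact: bV.
    split; first exact: bU.
    apply: lt_of_near => //; first by case: xv.
    by apply: (cont _ v); split=> //; split; exact: eballS dc_d _ _.
  by split; [case: G|exact: eqE G].
have to_phi x v : eball xb d x -> eball vb d v -> limiting_subdiff psi x v ->
    limiting_subdiff phi x v.
  move=> xx vv xv'; have : (U `*` V `&` gph (limiting_subdiff psi)) (x, v).
    by split=> //; split; [exact: bU|exact: bV].
  by rewrite -gphE => -[].
split.
  exists d, 0; split=> // x u v xx [uv [ux vx]] _.
  have [uv' ->] := to_psi _ _ ux vx uv; rewrite mul0r mul0r sube0.
  by apply: le_trans (psi_le _ (bU _ xx)); exact: convex_limiting_subdiff.
have d2 : 0 < d / 2 by rewrite divr_gt0.
have half (a b c : 'rV[R]_n) : eball a (d / 2) b -> eball b (d / 2) c -> eball a d c.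
  by rewrite /eball /=; have := enorm_tri b c a; lra.
have halfW (a b : 'rV[R]_n) : eball a (d / 2) b -> eball a d b by apply: eballS; lra.
exists (eball xb (d / 2)), (eball vb (d / 2)).
split; [exact: nbhs_eball|exact: nbhs_eball|].
move=> x y w z /regular_normal_coneP[_ H] [xy [xx yy]].
apply: (@convex_normal_positive psi x y w z (d / 2)) => //.
  by have [] := to_psi _ _ (halfW _ _ xx) (halfW _ _ yy) xy.
move=> e e0; have [d1 d10 K] := H _ e0; exists d1 => // x' y' xy' xd yd xd1 yd1.
apply: K => //; apply: to_phi => //; [exact: half _ _ _ xx xd|exact: half _ _ _ yy yd].
Qed.

(** A limiting normal is a limit of regular normals at nearby graph points, and the sign passes to
    the limit by continuity of [dot]. *)
Lemma limiting_normal_positive phi xb vb :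
  (exists U V : set 'rV[R]_n, [/\ nbhs xb U, nbhs vb V &
     forall x y w z, combined_subdiff2 phi x y w z ->
       (gph (limiting_subdiff phi) `&` (U `*` V)) (x, y) -> 0 <= dot z w]) ->
  exists U V : set 'rV[R]_n, [/\ nbhs xb U, nbhs vb V &
     forall x y w z, limiting_subdiff2 phi x y w z ->
       (gph (limiting_subdiff phi) `&` (U `*` V)) (x, y) -> 0 <= dot z w].
Proof.
case=> U [V [/nbhs_eballP[dU dU0 UU] /nbhs_eballP[dV dV0 VV] pos]].
exists (eball xb (dU / 2)), (eball vb (dV / 2)).
have [dU2 dV2] : 0 < dU / 2 /\ 0 < dV / 2 by rewrite !divr_gt0.
split; [exact: nbhs_eball|exact: nbhs_eball|].
move=> x y w z [_ [p_ [q_ [p_x _ pq q_z]]]] [_ [xx yy]].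
have sub_enorm (a b : 'rV[R]_(n + n)) :
    enorm (lsubmx a - lsubmx b) <= enorm (a - b) /\
    enorm (rsubmx a - rsubmx b) <= enorm (a - b).
  rewrite -!linearB /= -{2 4}(hsubmxK (a - b)).
  by rewrite enorm_row_mx_gel enorm_row_mx_ger.
have cvg_sub : (fun k => lsubmx (q_ k)) @ \oo --> z /\
    (fun k => rsubmx (q_ k)) @ \oo --> - w.
  split=> A /nbhs_eballP[d d0 dA]; apply: filterS (cvg_eball q_z d0) => k qk;
    apply: dA; have [L M] := sub_enorm (q_ k) (row_mx z (- w)).
    by move: L; rewrite row_mxKl => /le_trans; apply.
  by move: M; rewrite row_mxKr => /le_trans; apply.
have cvk : (fun k => - dot (lsubmx (q_ k)) (rsubmx (q_ k))) @ \oo --> dot z w.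
  rewrite -[dot z w]opprK -dotNr; apply: cvgN.
  by apply: cvg_dot; case: cvg_sub.
apply: (closed_cvg _ (@closed_ge R 0) _ _ cvk).
near=> k.
have px : eball (row_mx x y) (dU / 2) (p_ k) by near: k; exact: cvg_eball.
have py : eball (row_mx x y) (dV / 2) (p_ k) by near: k; exact: cvg_eball.
have := pq k; rewrite -(hsubmxK (p_ k)) -{1}(hsubmxK (q_ k)).
rewrite -{1}[rsubmx (q_ k)]opprK => Hk.
have /regular_normal_coneP[Gk _] := Hk.
rewrite /= -dotNr; apply: (pos (lsubmx (p_ k)) (rsubmx (p_ k))) => //.
have [] := sub_enorm (p_ k) (row_mx x y); rewrite row_mxKl row_mxKr.
move: px py xx yy; rewrite /eball /= => px py xx yy L M.
split=> //; split => /=.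
  by apply: UU; rewrite /eball /=; have := enorm_tri x (lsubmx (p_ k)) xb; lra.
by apply: VV; rewrite /eball /=; have := enorm_tri y (rsubmx (p_ k)) vb; lra.
Unshelve. all: by end_near.
Qed.

End Equivalence.

Theorem theorem5p2 (R : realType) (n : nat) (phi : 'rV[R]_n -> \bar R)
    (xb vb : 'rV[R]_n)
    (phi_proper : proper_fun phi)
    (phi_lsc : lower_semicontinuous phi)
    (xb_dom : dom phi xb)
    (vb_subdiff : limiting_subdiff phi xb vb)
    (phi_subdiff_cont : subdiff_continuous phi xb vb) :
  [<-> (* (i) *)
       variationally_convex phi xb vb;
       (* (ii) *)
       prox_regular phi xb vb /\
       exists U V : set 'rV[R]_n, [/\ nbhs xb U, nbhs vb V &
         forall x y w z : 'rV[R]_n,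
           combined_subdiff2 phi x y w z ->
           (gph (limiting_subdiff phi) `&` (U `*` V)) (x, y) ->
           0 <= dot z w];
       (* (iii) *)
       prox_regular phi xb vb /\
       exists U V : set 'rV[R]_n, [/\ nbhs xb U, nbhs vb V &
         forall x y w z : 'rV[R]_n,
           limiting_subdiff2 phi x y w z ->
           (gph (limiting_subdiff phi) `&` (U `*` V)) (x, y) ->
           0 <= dot z w]].

Proof.
tfae.
- exact: variationally_convex_positive.
- by move=> [prox pos]; split=> //; exact: limiting_normal_positive.
(* (iii) gives (ii) because regular normals are limiting normals, and (ii) gives (i). *)
- case=> prox [U [V [xU vV pos]]].
  apply: positive_variationally_convex => //.
  exists U, V; split=> // x y w z zw; apply: pos.
  exact: regular_limiting.
Qed.
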